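(* Let $R$ be an $n$-Gorenstein ring and let $r$ be an integer with $0 < r \leq n$. Let $\mathcal{GP}_r$ be the class of left $R$-modules of Gorenstein-projective dimension at most $r$. Then $(\mathcal{GP}_r, (\mathcal{GP}_r)^\perp)$ is a complete cotorsion pair in the category of left $R$-modules.
   Context: A ring $R$ (associative with unit, not necessarily commutative) is a Gorenstein ring if it is left and right Noetherian and has finite injective dimension both as a left and as a right $R$-module; these two dimensions then coincide, and $R$ is called $n$-Gorenstein if their common value is $n$. A left $R$-module $X$ is Gorenstein-projective if there is an exact sequence $\cdots \to P_1 \to P_0 \to P^0 \to P^1 \to \cdots$ of projective modules which remains exact after applying $\mathrm{Hom}_R(-,P)$ for every projective $P$, and such that $X = \mathrm{Ker}(P^0 \to P^1)$. A module $X$ has Gorenstein-projective dimension at most $r$ if there is an exact sequence $0 \to C_r \to \cdots \to C_0 \to X \to 0$ with every $C_i$ Gorenstein-projective. For a class $\mathcal{A}$ of objects of an Abelian category, $\mathcal{A}^\perp = \{B : \mathrm{Ext}^1(A,B)=0 \text{ for all } A\in\mathcal{A}\}$ and ${}^\perp\mathcal{A} = \{B : \mathrm{Ext}^1(B,A)=0 \text{ for all } A\in\mathcal{A}\}$. A pair of classes $(\mathcal{A},\mathcal{B})$ is a cotorsion pair if $\mathcal{A} = {}^\perp\mathcal{B}$ and $\mathcal{B} = \mathcal{A}^\perp$. It is complete if for every object $X$ there are exact sequences $0 \to B \to A \to X \to 0$ and $0 \to X \to B' \to A' \to 0$ with $A,A'\in\mathcal{A}$ and $B,B'\in\mathcal{B}$.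 *)

(* Defs.v *)
From HB Require Import structures.
From mathcomp Require Import all_boot all_order all_algebra.

Set Implicit Arguments.
Unset Strict Implicit.
Unset Printing Implicit Defensive.

Import GRing.Theory.
Local Open Scope ring_scope.

(* Rings are [pzRingType]s (unital, possibly noncommutative, possibly zero) and
   left R-modules are [lmodType R]s.  Right R-modules are left modules over the
   converse ring [R^c]; as a right module over itself, R is [(R^c)^o]. *)

Section Modules.
Variable R : pzRingType.
Implicit Types A B C I M P Q X Y : lmodType R.

Definition zero_module M := forall x : M, x = 0.

Definition surjective_map A B (f : A -> B) := forall y, exists x, f x = y.

(* Exactness of A -f-> B -g-> C at B. *)
Definition exact_at A B C (f : {linear A -> B}) (g : {linear B -> C}) :=
  forall y : B, g y = 0 <-> exists x : A, f x = y.

(* Exactness of Hom(C, Q) -> Hom(B, Q) -> Hom(A, Q) at Hom(B, Q). *)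
Definition hom_exact_at Q A B C (f : {linear A -> B}) (g : {linear B -> C}) :=
  forall h : {linear B -> Q},
    (forall x, h (f x) = 0) <-> (exists k : {linear C -> Q}, forall y, k (g y) = h y).

Definition short_exact A B C (f : {linear A -> B}) (g : {linear B -> C}) :=
  [/\ injective f, exact_at f g & surjective_map g].

Definition projective_module P :=
  forall A B (g : {linear A -> B}) (f : {linear P -> B}),
    surjective_map g -> exists h : {linear P -> A}, forall x, g (h x) = f x.

Definition injective_module I :=
  forall A B (i : {linear A -> B}) (f : {linear A -> I}),
    injective i -> exists h : {linear B -> I}, forall x, h (i x) = f x.

(* Ascending chain condition on submodules.  Boolean predicates represent
   arbitrary subsets once classical logic is assumed. *)
Definition noetherian_module M :=
  forall S : nat -> {pred M},
    (forall i, GRing.submod_closed (S i)) ->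
    (forall i, {subset S i <= S i.+1}) ->
    exists N, forall i, (N <= i)%N -> S i =i S N.

(* 0 -> M -> I_0 -> ... -> I_n -> 0 exact with every I_i injective, the
   finite sequence being continued by zero modules after I_n. *)
Definition injective_dim_le M (n : nat) :=
  exists (I : nat -> lmodType R) (e : {linear M -> I 0%N})
         (d : forall i, {linear I i -> I i.+1}),
    [/\ forall i, (i <= n)%N -> injective_module (I i),
        forall i, (n < i)%N -> zero_module (I i),
        injective e,
        exact_at e (d 0%N)
      & forall i, exact_at (d i) (d i.+1)].

Definition injective_dim M (n : nat) :=
  injective_dim_le M n /\ forall m, injective_dim_le M m -> (n <= m)%N.

(* A -f-> B -g-> C is exact at B and stays so under Hom(-, Q), Q projective. *)
Definition totally_exact_at A B C (f : {linear A -> B}) (g : {linear B -> C}) :=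
  exact_at f g /\ forall Q, projective_module Q -> hom_exact_at Q f g.

(* The complete resolution ... -> L_1 -> L_0 -c-> U_0 -> U_1 -> ... is given as
   two halves, L_i and U_i being the P_i and P^i, joined by c : P_0 -> P^0;
   j identifies X with Ker(U_0 -> U_1). *)
Definition gorenstein_projective X :=
  exists (L U : nat -> lmodType R)
         (dL : forall i, {linear L i.+1 -> L i})
         (c : {linear L 0%N -> U 0%N})
         (dU : forall i, {linear U i -> U i.+1}),
    [/\ forall i, projective_module (L i) /\ projective_module (U i),
        forall i, totally_exact_at (dL i.+1) (dL i),
        totally_exact_at (dL 0%N) c /\ totally_exact_at c (dU 0%N),
        forall i, totally_exact_at (dU i) (dU i.+1)
      & exists j : {linear X -> U 0%N}, injective j /\ exact_at j (dU 0%N)].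

(* 0 -> C_r -> ... -> C_0 -> X -> 0 exact, continued by zero modules. *)
Definition gorenstein_projective_dim_le (r : nat) X :=
  exists (C : nat -> lmodType R) (e : {linear C 0%N -> X})
         (d : forall i, {linear C i.+1 -> C i}),
    [/\ forall i, (i <= r)%N -> gorenstein_projective (C i),
        forall i, (r < i)%N -> zero_module (C i),
        surjective_map e,
        exact_at (d 0%N) e
      & forall i, exact_at (d i.+1) (d i)].

(* Yoneda Ext^1(A, B): extensions 0 -> B -> E -> A -> 0 up to equivalence, with
   the class of the split extension as zero element. *)
Record extension A B := Extension {
  ext_mid : lmodType R;
  ext_in : {linear B -> ext_mid};
  ext_out : {linear ext_mid -> A};
  ext_exact : short_exact ext_in ext_out
}.

Definition ext_equiv A B (E F : extension A B) :=
  exists phi : {linear ext_mid E -> ext_mid F},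
    (forall b, phi (ext_in E b) = ext_in F b) /\
    (forall x, ext_out F (phi x) = ext_out E x).

Section Split.
Variables A B : lmodType R.

Definition split_in (b : B) : B * A := (b, 0).

Fact split_in_is_linear : linear split_in.
Proof. by move=> a u v; congr (_, _) => /=; rewrite scaler0 addr0. Qed.

HB.instance Definition _ :=
  GRing.isLinear.Build R B (B * A)%type *:%R split_in split_in_is_linear.

Definition split_out (x : B * A) : A := x.2.

Fact split_out_is_linear : linear split_out.
Proof. by []. Qed.

HB.instance Definition _ :=
  GRing.isLinear.Build R (B * A)%type A *:%R split_out split_out_is_linear.

Fact split_exact : short_exact split_in split_out.
Proof.
split=> [b b' [] // | [b a] | a]; last by exists (0, a).
by split=> [/= a0 | [b' [_ <-]] //]; exists b; rewrite /= /split_in -a0.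
Qed.

Definition split_extension : extension A B := Extension split_exact.

End Split.

Definition Ext1_eq0 A B := forall E : extension A B, ext_equiv E (split_extension A B).

Definition module_class := lmodType R -> Prop.
Implicit Types F G : module_class.

Definition right_orth F : module_class := fun Y => forall X, F X -> Ext1_eq0 X Y.

Definition left_orth G : module_class := fun X => forall Y, G Y -> Ext1_eq0 X Y.

Definition cotorsion_pair F G :=
  (forall X, F X <-> left_orth G X) /\ (forall Y, G Y <-> right_orth F Y).

Definition complete_cotorsion_pair F G :=
  cotorsion_pair F G /\
  forall X,
    (exists (A B : lmodType R) (f : {linear B -> A}) (g : {linear A -> X}),
       [/\ F A, G B & short_exact f g]) /\
    (exists (A B : lmodType R) (f : {linear X -> B}) (g : {linear B -> A}),
       [/\ F A, G B & short_exact f g]).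

End Modules.

(* Gorenstein, with common value n of the left and right self-injective
   dimensions. *)
Definition n_gorenstein (n : nat) (R : pzRingType) :=
  [/\ noetherian_module (R^o : lmodType R),
      noetherian_module ((R^c)^o : lmodType R^c),
      injective_dim (R^o : lmodType R) n
    & injective_dim ((R^c)^o : lmodType R^c) n].

(* Main.v *)
Require Import Defs.
From HB Require Import structures.
From mathcomp Require Import all_boot all_order all_algebra.
From mathcomp Require Import boolp classical_sets functions.

Set Implicit Arguments.
Unset Strict Implicit.
Unset Printing Implicit Defensive.

Import GRing.Theory.
Local Open Scope ring_scope.

(** Modules of Gorenstein projective dimension at most [r] are described by
    vanishing of extension groups, and the cotorsion pair is generated by the
    small modules of this class.

    Let W be the class of modules of injective dimension at most [n].  Over an
    [n]-Gorenstein ring the members of W have projective dimension at most [n]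
    ([inj_dim_proj_dim]).  This rests on two facts about flat modules.  They
    belong to W, because a cocycle on a resolution by finitely generated free
    modules is a finite system of equations, which the equational criterion
    solves through the ring ([flat_inj_dim]).  And the [n]-th syzygy of an
    injective module is flat, by duality with right modules
    ([Tor_vanish_injective]); since its own syzygy is flat too, hence in W, its
    free presentation splits and it is projective ([injective_proj_dim]).

    For any class of modules, its small members generate a cotorsion pair with
    special preenvelopes ([small_orth_preenvelope]).  Instead of a transfinite
    chain of pushouts, the preenvelope of [X] is the free algebra over [X] with
    infinitary operations that solve the required extension problems: terms
    modulo the least suitable congruence ([small_object]).  Recursion on terms
    is its lifting property, and this lifting property says that [X] embeds in
    it with a cokernel in the left class.

    Applied to the left orthogonal of W, this gives exact sequences
    [0 -> X -> N -> G -> 0] with [N] in W and [G] orthogonal to W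
    ([inj_dim_preenvelope]).  If [X] is orthogonal to W too, then [N] is
    projective, and by iteration [X] has a complete resolution.  So being
    Gorenstein-projective is orthogonality to W, and Gorenstein projective
    dimension at most [r] is the vanishing of the extension groups in degree
    [r + 1] against W ([gorenstein_projective_dimP]).  The class is therefore
    the left orthogonal of the cosyzygies of order [r] of W, and equals its
    double orthogonal ([double_orth_gproj]).

    What remains is that a module orthogonal to the small members of the class
    is orthogonal to all of them ([small_orth_gproj]).  The sequence
    [0 -> M -> N -> G -> 0] reduces this from [M] to the module [N] of finite
    projective dimension, at most [r].  A free resolution of [N] is exhausted by
    resolutions on subsets of its bases which grow by few elements at a time
    ([closed_extension]), and a lifting problem for [N] is solved along such a
    chain because its steps are small modules of projective dimension at most
    [r] ([layer_extend], [small_proj_dim_Ext1]).  The special precovers follow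
    from the special preenvelopes by a pushout ([gproj_special_precover]). *)

(** * Linear maps, submodules and quotients *)

Section LinearMaps.
Variable R : pzRingType.
Implicit Types A B C M Q : lmodType R.

Definition Lin A B (f : A -> B) (Hf : linear f) : {linear A -> B} :=
  HB.pack f (GRing.isLinear.Build R A B *:%R f Hf).

Lemma linear_inj A B (f : {linear A -> B}) :
  (forall x, f x = 0 -> x = 0) -> injective f.
Proof.
by move=> h x y e; apply/subr0_eq/h; rewrite linearB e subrr.
Qed.

Record submodule M := Submodule {
  smem :> M -> Prop;
  smem0 : smem 0;
  smemP : forall a u v, smem u -> smem v -> smem (a *: u + v) }.

Lemma smemD M (S : submodule M) u v : S u -> S v -> S (u + v).
Proof. by move=> hu hv; rewrite -[u]scale1r; apply: smemP. Qed.

Lemma smemZ M (S : submodule M) a u : S u -> S (a *: u).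
Proof. by move=> hu; rewrite -[_ *: _]addr0; apply: smemP => //; apply: smem0. Qed.

Lemma smemN M (S : submodule M) u : S u -> S (- u).
Proof. by rewrite -scaleN1r; apply: smemZ. Qed.

Lemma smemB M (S : submodule M) u v : S u -> S v -> S (u - v).
Proof. by move=> hu hv; apply: smemD => //; apply: smemN. Qed.

Lemma smem_sum M (S : submodule M) (I : Type) (s : seq I) (f : I -> M) :
  (forall i, S (f i)) -> S (\sum_(i <- s) f i).
Proof.
by move=> h; apply: (big_ind S) => // [|x y]; [apply: smem0 | apply: smemD].
Qed.

Lemma kernel_subproof A B (f : {linear A -> B}) a u v :
  f u = 0 -> f v = 0 -> f (a *: u + v) = 0.
Proof. by move=> eu ev; rewrite linearP eu ev scaler0 addr0. Qed.

Definition kernel A B (f : {linear A -> B}) : submodule A :=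
  @Submodule A (fun x => f x = 0) (linear0 f) (@kernel_subproof A B f).

Lemma image_subproof A B (f : {linear A -> B}) a u v :
  (exists x, f x = u) -> (exists x, f x = v) -> exists x, f x = a *: u + v.
Proof. by case=> x <- [y <-]; exists (a *: x + y); rewrite linearP. Qed.

Definition lin_image A B (f : {linear A -> B}) : submodule B :=
  @Submodule B (fun y => exists x, f x = y) (ex_intro _ 0 (linear0 f))
    (@image_subproof A B f).

Lemma comp_linear A B C (g : {linear B -> C}) (f : {linear A -> B}) : linear (g \o f).
Proof. by move=> a u v; rewrite /= !linearP. Qed.

Definition lin_comp A B C (g : {linear B -> C}) (f : {linear A -> B}) : {linear A -> C} :=
  Lin (comp_linear g f).

Lemma sub_linear A B (f g : {linear A -> B}) : linear (fun x => f x - g x).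
Proof. by move=> a u v; rewrite !linearP addrACA scalerDr. Qed.

Definition sub_lin A B (f g : {linear A -> B}) : {linear A -> B} := Lin (sub_linear f g).

Lemma id_linear A : linear (fun x : A => x).
Proof. by []. Qed.

Definition id_lin A : {linear A -> A} := Lin (@id_linear A).

End LinearMaps.

Section SubmoduleType.
Variables (R : pzRingType) (M : lmodType R) (S : submodule M).

Record sub_of := SubOf { sub_val : M; sub_valP : `[< S sub_val >] }.

HB.instance Definition _ := [isSub for sub_val].
HB.instance Definition _ := [Choice of sub_of by <:].

Lemma sub_valS x : S (sub_val x).
Proof. exact/asboolP/sub_valP. Qed.

Fact sub_closed : GRing.subsemimod_closed (fun x : M => `[< S x >]).
Proof.
split=> [|a u /asboolP hu]; last by apply/asboolP/smemZ.
split; first exact/asboolP/smem0.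
by move=> u v /asboolP hu /asboolP hv; apply/asboolP/smemD.
Qed.

HB.instance Definition _ :=
  GRing.SubChoice_isSubLmodule.Build R M _ sub_of sub_closed.

Fact sub_val_linear : linear sub_val.
Proof. by move=> a u v; rewrite [LHS](linearP (val : sub_of -> M)). Qed.

Definition sub_incl : {linear sub_of -> M} := Lin sub_val_linear.

Lemma sub_incl_inj : injective sub_incl.
Proof. exact: val_inj. Qed.

Lemma sub_inclP x : S x <-> exists y, sub_incl y = x.
Proof.
split=> [Sx|[[y Sy] <-]]; last exact/asboolP.
by exists (SubOf (asboolT Sx)).
Qed.

End SubmoduleType.
Arguments sub_incl {R M} S.

(** Quotients in general: both the quotient by a submodule and the free algebra
    of terms are instances.  The carrier consists of the values of a choice of
    normal forms. *)
Section SetoidModule.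
Variables (R : pzRingType) (T : Type) (eqv : T -> T -> Prop).
Variables (zero : T) (add : T -> T -> T) (scale : R -> T -> T).
Hypothesis eqv_refl : forall x, eqv x x.
Hypothesis eqv_sym : forall x y, eqv x y -> eqv y x.
Hypothesis eqv_trans : forall x y z, eqv x y -> eqv y z -> eqv x z.
Hypothesis add_eqv : forall x x' y y', eqv x x' -> eqv y y' -> eqv (add x y) (add x' y').
Hypothesis scale_eqv : forall a x x', eqv x x' -> eqv (scale a x) (scale a x').
Hypothesis addA : forall x y z, eqv (add x (add y z)) (add (add x y) z).
Hypothesis addC : forall x y, eqv (add x y) (add y x).
Hypothesis add0 : forall x, eqv (add zero x) x.
Hypothesis scaleA : forall a b x, eqv (scale a (scale b x)) (scale (a * b) x).
Hypothesis scale1 : forall x, eqv (scale 1 x) x.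
Hypothesis scale0 : forall x, eqv (scale 0 x) zero.
Hypothesis scaleDr : forall a x y, eqv (scale a (add x y)) (add (scale a x) (scale a y)).
Hypothesis scaleDl : forall a b x, eqv (scale (a + b) x) (add (scale a x) (scale b x)).

Let rep (x : T) : T := projT1 (cid (ex_intro (eqv x) x (eqv_refl x))).
Let rep_eqv x : eqv x (rep x). Proof. by rewrite /rep; case: cid. Qed.
Let rep_eq x y : eqv x y -> rep x = rep y.
Proof.
move=> exy; rewrite /rep.
have epred : eqv x = eqv y.
  apply/funext => z; apply/propext; split; last exact: eqv_trans.
  by apply: eqv_trans; apply: eqv_sym.
have cidE (P Q : T -> Prop) (p : exists t, P t) (q : exists t, Q t) :
    P = Q -> projT1 (cid p) = projT1 (cid q).
  by move=> ePQ; subst Q; rewrite (Prop_irrelevance p q).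
exact: cidE.
Qed.
Let rep_id x : rep (rep x) = rep x.
Proof. by apply/rep_eq/eqv_sym/rep_eqv. Qed.

Definition setoid_mod := {x : {classic T} | `[< rep x = x >]}.

Let cls (x : T) : setoid_mod := exist _ (rep x) (asboolT (rep_id x)).
Let clsP x y : cls x = cls y <-> eqv x y.
Proof.
split=> [[e]|e]; last by apply/val_inj/rep_eq.
by apply: (eqv_trans (rep_eqv x)); rewrite e; apply/eqv_sym/rep_eqv.
Qed.
Let lift (u : setoid_mod) : T := val u.
Let liftK u : cls (lift u) = u.
Proof. by apply/val_inj/asboolP; case: u. Qed.

Let sadd u v := cls (add (lift u) (lift v)).
Let sopp u := cls (scale (-1) (lift u)).
Let sscale a u := cls (scale a (lift u)).
Let lift_cls x : eqv (lift (cls x)) x. Proof. by apply/clsP; rewrite liftK. Qed.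
Let clsD x y : cls (add x y) = sadd (cls x) (cls y).
Proof. by apply/clsP/eqv_sym/add_eqv; apply: lift_cls. Qed.
Let clsZ a x : cls (scale a x) = sscale a (cls x).
Proof. by apply/clsP/eqv_sym/scale_eqv; apply: lift_cls. Qed.

Let saddA : associative sadd.
Proof.
move=> u v w; rewrite -[u]liftK -[v]liftK -[w]liftK -!clsD; exact/clsP/addA.
Qed.
Let saddC : commutative sadd.
Proof. by move=> u v; apply/clsP. Qed.
Let sadd0 : left_id (cls zero) sadd.
Proof. by move=> u; rewrite -[u]liftK -clsD; apply/clsP/add0. Qed.
Let saddN : left_inverse (cls zero) sopp sadd.
Proof.
move=> u; rewrite -[u]liftK /sopp clsZ liftK -clsZ -clsD; apply/clsP.
apply: (eqv_trans (add_eqv (eqv_refl _) (eqv_sym (scale1 _)))).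
by apply: (eqv_trans (eqv_sym (scaleDl _ _ _))); rewrite addNr; apply: scale0.
Qed.
Let sscaleA a b u : sscale a (sscale b u) = sscale (a * b) u.
Proof. by rewrite -[u]liftK -!clsZ; apply/clsP/scaleA. Qed.
Let sscale1 : left_id 1 sscale.
Proof. by move=> u; rewrite -[u]liftK -!clsZ; apply/clsP/scale1. Qed.
Let sscaleDr : right_distributive sscale sadd.
Proof.
move=> a u v; rewrite -[u]liftK -[v]liftK -clsD -!clsZ -clsD; apply/clsP/scaleDr.
Qed.
Let sscaleDl u : {morph sscale^~ u : a b / a + b >-> sadd a b}.
Proof. by move=> a b; rewrite -[u]liftK -!clsZ -clsD; apply/clsP/scaleDl. Qed.

HB.instance Definition _ := Choice.on setoid_mod.
HB.instance Definition _ := GRing.isZmodule.Build setoid_mod saddA saddC sadd0 saddN.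
HB.instance Definition _ := GRing.Zmodule_isLmodule.Build R setoid_mod
  sscaleA sscale1 sscaleDr sscaleDl.

Lemma setoid_module_exists : exists (Q : lmodType R) (c : T -> Q),
  [/\ forall u, exists x, c x = u, forall x y, c x = c y <-> eqv x y,
      forall x y, c (add x y) = c x + c y & forall a x, c (scale a x) = a *: c x].
Proof.
exists setoid_mod, cls; split => // u; by exists (lift u).
Qed.

End SetoidModule.

Section Quotients.
Variable R : pzRingType.
Implicit Types A B C E K M P Q X Y Z : lmodType R.

Lemma quotient_exists M (S : submodule M) :
  exists (Q : lmodType R) (p : {linear M -> Q}),
    surjective_map p /\ forall x, p x = 0 <-> S x.
Proof.
have [|x y|x y z|x x' y y'|a x x'|x y z|x y|x|a b x|x|x|a x y|a b x|Q [c [c_surj cP cD cZ]]] :=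
  @setoid_module_exists R M (fun x y => S (x - y)) 0 +%R *:%R.
- by move=> x; rewrite subrr; apply: smem0.
- by move/smemN; rewrite opprB.
- by move=> h1 h2; rewrite -(subrKA y); apply: smemD.
- by move=> h1 h2; rewrite opprD addrACA; apply: smemD.
- by move=> h; rewrite -scalerBr; apply: smemZ.
- by rewrite addrA subrr; apply: smem0.
- by rewrite [x + y]addrC subrr; apply: smem0.
- by rewrite add0r subrr; apply: smem0.
- by rewrite scalerA subrr; apply: smem0.
- by rewrite scale1r subrr; apply: smem0.
- by rewrite scale0r subrr; apply: smem0.
- by rewrite scalerDr subrr; apply: smem0.
- by rewrite scalerDl subrr; apply: smem0.
have cL : linear c by move=> a u v; rewrite cD cZ.
exists Q, (Lin cL); split=> // x; have c0 : c 0 = 0 := linear0 (Lin cL).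
by rewrite /= -c0 cP subr0.
Qed.

Lemma factor_surj A Q Y (p : {linear A -> Q}) (f : {linear A -> Y}) :
  surjective_map p -> (forall x, p x = 0 -> f x = 0) ->
  exists g : {linear Q -> Y}, forall x, g (p x) = f x.
Proof.
move=> p_surj kpf; have [s sK] := choice p_surj.
have key x y : p x = p y -> f x = f y.
  by move=> e; apply/subr0_eq; rewrite -linearB kpf // linearB e subrr.
have gL : linear (f \o s).
  move=> a u v /=; rewrite -linearP; apply: key.
  by rewrite linearP !sK.
by exists (Lin gL) => x /=; apply: key; rewrite sK.
Qed.

Lemma factor_inj A K Z (i : {linear K -> A}) (f : {linear Z -> A}) :
  injective i -> (forall z, exists x, i x = f z) ->
  exists g : {linear Z -> K}, forall z, i (g z) = f z.
Proof.
move=> i_inj /choice[g gE].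
have gL : linear g by move=> a u v; apply: i_inj; rewrite linearP !gE linearP.
by exists (Lin gL).
Qed.

Lemma kernel_short_exact A B (g : {linear A -> B}) :
  surjective_map g -> short_exact (sub_incl (kernel g)) g.
Proof.
move=> g_surj; split=> //; first exact: sub_incl_inj.
by move=> y; exact: (sub_inclP (kernel g)).
Qed.

Lemma cokernel_exists A B (f : {linear A -> B}) :
  injective f -> exists (C : lmodType R) (g : {linear B -> C}), short_exact f g.
Proof.
move=> f_inj; have [C [g [g_surj gE]]] := quotient_exists (lin_image f).
by exists C, g.
Qed.

(** The pushout of [i] and [j], as the quotient of [E * B] by the antidiagonal
    copy of [K]. *)
Lemma pushout_exists K E B (i : {linear K -> E}) (j : {linear K -> B}) :
  exists (P : lmodType R) (u : {linear E -> P}) (v : {linear B -> P}),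
  [/\ forall k, u (i k) = v (j k),
      forall z, exists x y, z = u x + v y
    & forall x y, u x = v y -> exists k, i k = x /\ j k = y].
Proof.
have tL : linear (fun k => (i k, - j k) : E * B).
  by move=> a u v; rewrite !linearP.
have [P [p [p_surj pE]]] := quotient_exists (lin_image (Lin tL)).
have uL : linear (fun x : E => p (x, 0)).
  move=> a x y; rewrite -linearP; congr (p (_, _)); by rewrite /= scaler0 addr0.
have vL : linear (fun y : B => p (0, y)).
  move=> a x y; rewrite -linearP; congr (p (_, _)); by rewrite /= scaler0 addr0.
exists P, (Lin uL), (Lin vL); split=> /= [k|z|x y].
- apply/subr0_eq; rewrite -linearB /=; apply/pE; exists k => /=.
  by congr (_, _); rewrite /= ?subr0 ?sub0r.
- have [[x y] <-] := p_surj z; exists x, y; rewrite -linearD; congr (p (_, _)) => /=.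
    by rewrite addr0.
  by rewrite add0r.
- move/eqP; rewrite -subr_eq0 -linearB => /eqP/pE[k /= [e1 e2]]; exists k.
  rewrite e1 /= subr0; split=> //.
  by apply: oppr_inj; rewrite e2 /= sub0r.
Qed.

(** Stated for the properties of the pushout square rather than for its
    construction, so that it can be applied to the square in both directions. *)
Lemma pushout_short_exact K E A B P (i : {linear K -> E}) (q : {linear E -> A})
    (j : {linear K -> B}) (u : {linear E -> P}) (v : {linear B -> P}) :
  short_exact i q ->
  (forall k, u (i k) = v (j k)) -> (forall z, exists x y, z = u x + v y) ->
  (forall x y, u x = v y -> exists k, i k = x /\ j k = y) ->
  exists w : {linear P -> A}, short_exact v w /\ forall x, w (u x) = q x.
Proof.
move=> [i_inj iq q_surj] uv span ker.
have kq k : q (i k) = 0 by apply/iq; exists k.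
have sL : linear (fun z : E * B => u z.1 + v z.2).
  by move=> a [x y] [x' y'] /=; rewrite !linearP scalerDr addrACA.
have fL : linear (fun z : E * B => q z.1).
  by move=> a [x y] [x' y'] /=; rewrite linearP.
have s_surj : surjective_map (Lin sL).
  by move=> z; have [x [y ->]] := span z; exists (x, y).
have [|w wE] := @factor_surj _ _ _ (Lin sL) (Lin fL) s_surj.
  move=> [x y] /= e; have /ker[k [<- _]] : u x = v (- y).
    by rewrite linearN; apply/eqP; rewrite -addr_eq0 e.
  exact: kq.
have wu x : w (u x) = q x.
  by have := wE (x, 0); rewrite /= linear0 addr0.
have wv y : w (v y) = 0.
  by have := wE (0, y); rewrite /= !linear0 add0r.
exists w; split=> //; split.
- apply: linear_inj => y e; have /ker[k [ik <-]] : u 0 = v y by rewrite linear0.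
  have -> : k = 0 by apply: i_inj; rewrite ik linear0.
  by rewrite linear0.
- move=> z; split=> [|[y <-] //]; have [x [y ->]] := span z.
  rewrite linearD wu wv addr0 => /iq[k <-].
  by exists (j k + y); rewrite linearD uv.
- by move=> a; have [x <-] := q_surj a; exists (u x).
Qed.

End Quotients.

(** * Free modules *)

Section FreeModules.
Variables (R : pzRingType) (B : Type).
Implicit Types (b : B) (M : lmodType R) (S : B -> Prop).

Definition finite_support_pred (f : B -> R^o) :=
  exists s : seq {classic B}, forall b : {classic B}, f b <> 0 -> b \in s.

Fact finite_support0 : finite_support_pred 0.
Proof. by exists [::]. Qed.

Fact finite_supportP a f g :
  finite_support_pred f -> finite_support_pred g -> finite_support_pred (a *: f + g).
Proof.
case=> s sP [t tP]; exists (s ++ t) => b h; rewrite mem_cat.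
have [e|/sP -> //] := EM (f b = 0); have [e'|/tP ->] := EM (g b = 0).
  by case: h; rewrite !fctE e e' scaler0 addr0.
by rewrite orbT.
Qed.

Definition finite_support := Submodule finite_support0 finite_supportP.

Definition free_module : lmodType R := sub_of finite_support.

Definition coeff (x : free_module) b : R := sub_val x b.
Arguments coeff : simpl never.

Lemma coeffP a x y b : coeff (a *: x + y) b = a * coeff x b + coeff y b.
Proof. by []. Qed.

Lemma coeffD x y b : coeff (x + y) b = coeff x b + coeff y b.
Proof. by []. Qed.

Lemma coeffZ a x b : coeff (a *: x) b = a * coeff x b.
Proof. by []. Qed.

Lemma coeff0 b : coeff 0 b = 0.
Proof. by []. Qed.

Lemma coeff_sum (I : Type) (s : seq I) (f : I -> free_module) b :
  coeff (\sum_(i <- s) f i) b = \sum_(i <- s) coeff (f i) b.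
Proof. by elim/big_ind2: _ => // x1 x2 y1 y2 <- <-. Qed.

Lemma coeff_inj x y : coeff x =1 coeff y -> x = y.
Proof. by move=> e; apply/val_inj/funext. Qed.

Lemma from_coefs (f : B -> R) (s : seq {classic B}) :
  (forall b : {classic B}, f b <> 0 -> b \in s) -> exists x, coeff x =1 f.
Proof.
move=> fs; have h : finite_support f by exists s.
by exists (SubOf (asboolT h)).
Qed.

Fact delta_subproof b : finite_support (fun b' => if `[< b = b' >] then 1 else 0).
Proof. by exists [:: b : {classic B}] => b'; case: asboolP => // ->; rewrite inE. Qed.

Definition delta b : free_module := SubOf (asboolT (delta_subproof b)).

Lemma coeff_delta b b' : coeff (delta b) b' = if `[< b = b' >] then 1 else 0.
Proof. by []. Qed.

Fact supp_exists x :
  exists s : seq {classic B}, uniq s /\ forall b : {classic B}, b \in s <-> coeff x b <> 0.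
Proof.
have /asboolP[s sP] := sub_valP x.
exists (undup (filter (fun b : {classic B} => `[< coeff x b <> 0 >]) s)); split; first exact: undup_uniq.
move=> b; rewrite mem_undup mem_filter; split; first by case/andP => /asboolP.
by move=> h; rewrite sP // andbT; apply/asboolP.
Qed.

Definition supp x : seq {classic B} := projT1 (cid (supp_exists x)).

Lemma supp_uniq x : uniq (supp x).
Proof. by rewrite /supp; case: cid => s []. Qed.

Lemma mem_supp x (b : {classic B}) : b \in supp x <-> coeff x b <> 0.
Proof. by rewrite /supp; case: cid => s []. Qed.

Definition free_ext_fun M (g : B -> M) (x : free_module) : M :=
  \sum_(b <- supp x) coeff x b *: g b.

(** The sum over the support can be taken over any larger duplicate-free list;
    a common list for several elements makes additivity visible. *)
Lemma free_ext_large M (g : B -> M) x (s : seq {classic B}) :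
  uniq s -> {subset supp x <= s} -> free_ext_fun g x = \sum_(b <- s) coeff x b *: g b.
Proof.
move=> s_uniq sub; rewrite (bigID (mem (supp x))) /= [X in _ + X]big1 ?addr0; last first.
  move=> b /negP h; have [->|] := EM (coeff x b = 0); first by rewrite scale0r.
  by move/mem_supp.
rewrite -big_filter; apply: perm_big; apply: uniq_perm => [||b].
- exact: supp_uniq.
- exact: filter_uniq.
- rewrite mem_filter; apply/idP/idP => [h|/andP[] //].
  by rewrite h /= sub.
Qed.

Fact free_ext_linear M (g : B -> M) : linear (free_ext_fun g).
Proof.
move=> a x y; set s := undup (supp x ++ supp y ++ supp (a *: x + y)).
have s_uniq : uniq s := undup_uniq _.
rewrite !(@free_ext_large M g _ s) //; first last.
- by move=> b; rewrite mem_undup !mem_cat => ->; rewrite ?orbT.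
- by move=> b; rewrite mem_undup !mem_cat => ->; rewrite ?orbT.
- by move=> b; rewrite mem_undup !mem_cat => ->; rewrite ?orbT.
rewrite scaler_sumr -big_split; apply: eq_bigr => b _ /=.
by rewrite coeffP scalerDl scalerA.
Qed.

Definition free_ext M (g : B -> M) : {linear free_module -> M} := Lin (free_ext_linear g).

Lemma free_ext_delta M (g : B -> M) b : free_ext g (delta b) = g b.
Proof.
rewrite /= (@free_ext_large M g _ [:: b]) //.
  rewrite big_seq1 coeff_delta; by case: asboolP => // e; rewrite scale1r.
by move=> b' /mem_supp; rewrite coeff_delta inE; case: asboolP => // ->.
Qed.

Lemma free_ext_mem M (N : submodule M) (g : B -> M) x :
  (forall b, coeff x b <> 0 -> N (g b)) -> N (free_ext g x).
Proof.
move=> h; rewrite /= /free_ext_fun big_seq; apply: (big_ind N).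
- exact: smem0.
- by move=> u v; apply: smemD.
- by move=> b /mem_supp/h; apply: smemZ.
Qed.

Lemma free_ext_eq M (g g' : B -> M) x :
  (forall b, coeff x b <> 0 -> g b = g' b) -> free_ext g x = free_ext g' x.
Proof.
move=> h; rewrite /= /free_ext_fun big_seq [RHS]big_seq.
by apply: eq_bigr => b /mem_supp/h ->.
Qed.

Lemma free_expand x : x = free_ext delta x.
Proof.
apply: coeff_inj => b; rewrite /= /free_ext_fun coeff_sum.
have [e|/mem_supp b_x] := EM (coeff x b = 0).
  rewrite big1_seq // => b' /andP[_ /mem_supp hb'].
  by rewrite coeffZ coeff_delta; case: asboolP => [eb|]; [rewrite eb in hb'|rewrite mulr0].
rewrite (bigD1_seq _ b_x (supp_uniq x)) /= big1 ?addr0 => [|b' /eqP hb'].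
  by rewrite coeffZ coeff_delta; case: asboolP => // ?; rewrite mulr1.
by rewrite coeffZ coeff_delta; case: asboolP => // ?; rewrite mulr0.
Qed.

Lemma linear_free_ext M (f : {linear free_module -> M}) x :
  f x = free_ext (fun b => f (delta b)) x.
Proof.
by rewrite {1}[x]free_expand /= /free_ext_fun linear_sum; apply: eq_bigr => b _; rewrite linearZ.
Qed.

Lemma free_linear_eq M (f g : {linear free_module -> M}) :
  (forall b, f (delta b) = g (delta b)) -> f =1 g.
Proof. by move=> h x; rewrite linear_free_ext [RHS]linear_free_ext; apply: free_ext_eq. Qed.

Lemma free_projective : projective_module free_module.
Proof.
move=> A C g f g_surj.
have [h hE] := choice (fun b => g_surj (f (delta b))).
exists (free_ext h); apply: (@free_linear_eq _ (lin_comp g (free_ext h))) => b.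
by rewrite -hE -[in RHS](free_ext_delta h).
Qed.

Fact bspan_subproof S a (x y : free_module) :
  (forall b, coeff x b <> 0 -> S b) -> (forall b, coeff y b <> 0 -> S b) ->
  forall b, coeff (a *: x + y) b <> 0 -> S b.
Proof.
move=> hx hy b; have [ex|/hx //] := EM (coeff x b = 0).
have [ey|/hy //] := EM (coeff y b = 0).
by rewrite coeffP ex ey mulr0 addr0.
Qed.

Fact bspan_subproof0 S b : coeff 0 b <> 0 -> S b.
Proof. by []. Qed.

Definition bspan S : submodule free_module :=
  @Submodule R free_module (fun x => forall b, coeff x b <> 0 -> S b)
    (@bspan_subproof0 S) (@bspan_subproof S).

Lemma bspan_delta S b : S b -> bspan S (delta b).
Proof. by move=> Sb b'; rewrite coeff_delta; case: asboolP => // <-. Qed.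

Lemma bspan_mem M (N : submodule M) S (f : {linear free_module -> M}) x :
  (forall b, S b -> N (f (delta b))) -> bspan S x -> N (f x).
Proof.
by move=> h Sx; rewrite linear_free_ext; apply: free_ext_mem => b /Sx/h.
Qed.

Lemma bspan_sub S S' x : bspan S x -> (forall b, S b -> S' b) -> bspan S' x.
Proof. by move=> Sx SS' b /Sx/SS'. Qed.

End FreeModules.
Arguments free_module R B : clear implicits.
Arguments delta {R B} b.
Arguments bspan {R B} S.

(** * First extension groups and syzygies *)

Section Ext.
Variable R : pzRingType.
Implicit Types A B C E F I K M P Q X Y Z : lmodType R.

Lemma short_exact_comp0 A B C (f : {linear A -> B}) (g : {linear B -> C}) x :
  short_exact f g -> g (f x) = 0.
Proof. by case=> _ fg _; apply/fg; exists x. Qed.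

Lemma section_of_retraction B E A (i : {linear B -> E}) (p : {linear E -> A})
    (r : {linear E -> B}) :
  short_exact i p -> (forall b, r (i b) = b) ->
  exists s : {linear A -> E}, forall a, p (s a) = a.
Proof.
move=> se rK; have [_ ip p_surj] := se.
have [|s sE] := @factor_surj R E A E p (sub_lin (id_lin E) (lin_comp i r)) p_surj.
  by move=> x /ip[b <-]; rewrite /= rK subrr.
exists s => a; have [x <-] := p_surj a.
by rewrite sE /= linearB (short_exact_comp0 _ se) subr0.
Qed.

Lemma retraction_of_section B E A (i : {linear B -> E}) (p : {linear E -> A})
    (s : {linear A -> E}) :
  short_exact i p -> (forall a, p (s a) = a) ->
  exists r : {linear E -> B}, forall b, r (i b) = b.
Proof.
move=> se sK; have [i_inj ip p_surj] := se.
have [|r rE] := @factor_inj R E B E i (sub_lin (id_lin E) (lin_comp s p)) i_inj.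
  by move=> x; apply/ip; rewrite /= linearB sK subrr.
exists r => b; apply: i_inj.
by rewrite rE /= (short_exact_comp0 _ se) linear0 subr0.
Qed.

(** A retraction is the first component of an equivalence with the split
    extension, and the second component is forced. *)
Lemma Ext1P A B :
  Ext1_eq0 A B <->
  forall E (i : {linear B -> E}) (p : {linear E -> A}),
    short_exact i p -> exists r : {linear E -> B}, forall b, r (i b) = b.
Proof.
split=> [h E i p se|h [E i p se]].
  have [phi [phi1 _]] := h (Extension se).
  have rL : linear (fun x => (phi x).1) by move=> a u v; rewrite linearP.
  by exists (Lin rL) => b /=; rewrite phi1.
have [r rK] := h E i p se.
have phiL : linear (fun x => (r x, p x) : B * A) by move=> a u v; rewrite !linearP.
exists (Lin phiL); split=> //= b.
by rewrite rK (short_exact_comp0 _ se).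
Qed.

(** The pushout of the extension along [f] splits. *)
Lemma Ext1_extend K E A B (i : {linear K -> E}) (p : {linear E -> A})
    (f : {linear K -> B}) :
  short_exact i p -> Ext1_eq0 A B -> exists g : {linear E -> B}, forall x, g (i x) = f x.
Proof.
move=> se /Ext1P h; have [P [u [v [uv sp ker]]]] := pushout_exists i f.
have [w [/h[r rK] _]] := pushout_short_exact se uv sp ker.
by exists (lin_comp r u) => x; rewrite /= uv rK.
Qed.

(** The pullback of the extension along [f] splits. *)
Lemma Ext1_lift B E C A (i : {linear B -> E}) (p : {linear E -> C})
    (f : {linear A -> C}) :
  short_exact i p -> Ext1_eq0 A B -> exists g : {linear A -> E}, forall x, p (g x) = f x.
Proof.
move=> se /Ext1P h; have [i_inj ip p_surj] := se.
have dL : linear (fun z : E * A => p z.1 - f z.2).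
  by move=> a [x y] [x' y'] /=; rewrite !linearP addrACA scalerDr.
(* The pullback of [p] and [f], inside [E * A]. *)
have [P [j [j_inj jP]]] : exists P (j : {linear P -> (E * A)%type}),
    injective j /\ forall z, p z.1 - f z.2 = 0 <-> exists y, j y = z.
  exists (sub_of (kernel (Lin dL))), (sub_incl _); split; first exact: sub_incl_inj.
  by move=> z; apply: (sub_inclP (kernel (Lin dL))).
have jE z : p (j z).1 = f (j z).2 by apply/subr0_eq/jP; exists z.
have inP x y : p x = f y -> exists z, j z = (x, y).
  by move=> e; apply/jP; rewrite /= e subrr.
have pi2L : linear (fun z => (j z).2) by move=> a u v; rewrite linearP.
have pi1L : linear (fun z => (j z).1) by move=> a u v; rewrite linearP.
have i0L : linear (fun b => (i b, 0) : E * A).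
  by move=> a u v; rewrite linearP; congr (_, _); rewrite /= scaler0 addr0.
have [|i' i'E] := @factor_inj R _ _ _ j (Lin i0L) j_inj.
  by move=> b; apply: inP; rewrite (short_exact_comp0 _ se) linear0.
have se' : short_exact i' (Lin pi2L).
  split.
  - move=> b b' e; have := i'E b; rewrite e i'E /= => -[] e'.
    exact: i_inj.
  - move=> z; split=> [/= e|[b <-]]; last by rewrite /= i'E.
    have /ip[b eb] : p (j z).1 = 0 by rewrite jE e linear0.
    exists b; apply: j_inj; rewrite i'E /=.
    by rewrite [RHS]surjective_pairing eb [in RHS]e.
  - move=> y; have [x ex] := p_surj (f y); have [z ez] := inP _ _ ex.
    by exists z; rewrite /= ez.
have [r rK] := h _ _ _ se'.
have [s sK] := section_of_retraction se' rK.
by exists (lin_comp (Lin pi1L) s) => x /=; rewrite jE; congr (f _); exact: sK.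
Qed.

(** Lift [p] to a map [h] from [F] to the extension, and correct [h] by an
    extension of its restriction to [K]: the difference descends to a section. *)
Lemma Ext1_of_extend K F A B (i : {linear K -> F}) (p : {linear F -> A}) :
  short_exact i p -> Ext1_eq0 F B ->
  (forall f : {linear K -> B}, exists g : {linear F -> B}, forall x, g (i x) = f x) ->
  Ext1_eq0 A B.
Proof.
move=> se extF ext; apply/Ext1P => E a q seE; have [a_inj aq q_surj] := seE.
have [h hE] := Ext1_lift p seE extF.
have [|f fE] := @factor_inj R _ _ _ a (lin_comp h i) a_inj.
  by move=> k; apply/aq; rewrite /= hE (short_exact_comp0 _ se).
have [g gE] := ext f; have [_ ip p_surj] := se.
have [|s sE] := @factor_surj R _ _ _ p (sub_lin h (lin_comp a g)) p_surj.
  by move=> x /ip[k <-]; rewrite /= gE fE subrr.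
apply: (retraction_of_section (s := s) seE) => y; have [x <-] := p_surj y.
by rewrite sE /= linearB hE (short_exact_comp0 _ seE) subr0.
Qed.

Lemma Ext1_of_lift B I C A (i : {linear B -> I}) (q : {linear I -> C}) :
  short_exact i q -> Ext1_eq0 A I ->
  (forall f : {linear A -> C}, exists g : {linear A -> I}, forall x, q (g x) = f x) ->
  Ext1_eq0 A B.
Proof.
move=> se extI lif; apply/Ext1P => E b p seE; have [b_inj bp p_surj] := seE.
have [h hE] := Ext1_extend i seE extI; have [i_inj iq _] := se.
have [|f fE] := @factor_surj R _ _ _ p (lin_comp q h) p_surj.
  by move=> x /bp[k <-]; rewrite /= hE (short_exact_comp0 _ se).
have [g gE] := lif f.
have [|r rE] := @factor_inj R _ _ _ i (sub_lin h (lin_comp g p)) i_inj.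
  by move=> x; apply/iq; rewrite /= linearB gE fE subrr.
exists r => x; apply: i_inj.
by rewrite rE /= hE (short_exact_comp0 _ seE) linear0 subr0.
Qed.

Lemma projective_Ext1 P B : projective_module P -> Ext1_eq0 P B.
Proof.
move=> pP; apply/Ext1P => E i p se; have [_ _ p_surj] := se.
by have [s sK] := pP _ _ p (id_lin P) p_surj; apply: retraction_of_section se sK.
Qed.

Lemma injective_Ext1 A I : injective_module I -> Ext1_eq0 A I.
Proof. by move=> iI; apply/Ext1P => E i p [i_inj _ _]; apply: iI _ _ i (id_lin I) i_inj. Qed.

Lemma Ext1_projective P : (forall B, Ext1_eq0 P B) -> projective_module P.
Proof.
by move=> h A B g f /kernel_short_exact se; apply: Ext1_lift se (h _).
Qed.

Lemma Ext1_injective I : (forall A, Ext1_eq0 A I) -> injective_module I.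
Proof.
move=> h A B i f /cokernel_exists[C [g se]]; exact: Ext1_extend se (h _).
Qed.

(** Both sides are the vanishing of the second extension group of [A] and [Y]:
    the left one says that the maps from [K] to [C] lift to [I], the right one
    that they extend to [P]. *)
Lemma dimension_shift K P A Y I C (i : {linear K -> P}) (p : {linear P -> A})
    (j : {linear Y -> I}) (q : {linear I -> C}) :
  short_exact i p -> short_exact j q -> projective_module P -> injective_module I ->
  Ext1_eq0 K Y <-> Ext1_eq0 A C.
Proof.
move=> seP seI pP iI; have [i_inj _ _] := seP; have [_ _ q_surj] := seI.
split=> h.
- apply: (Ext1_of_extend seP); first exact: projective_Ext1.
  move=> f; have [g gE] := Ext1_lift f seI h.
  have [g' g'E] := iI _ _ i g i_inj.
  by exists (lin_comp q g') => x; rewrite /= g'E.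
- apply: (Ext1_of_lift seI); first exact: injective_Ext1.
  move=> f; have [g gE] := Ext1_extend f seP h.
  have [g' g'E] := pP _ _ q g q_surj.
  by exists (lin_comp g' i) => x; rewrite /= g'E.
Qed.

(** Split the extension over [A'] first, and divide by the image of the section:
    what is left is an extension of [A'']. *)
Lemma Ext1_middle A' A A'' B (i : {linear A' -> A}) (p : {linear A -> A''}) :
  short_exact i p -> Ext1_eq0 A' B -> Ext1_eq0 A'' B -> Ext1_eq0 A B.
Proof.
move=> se h' h''; apply/Ext1P => E b q seE; have [b_inj bq q_surj] := seE.
have [s sE] := Ext1_lift i seE h'; have [i_inj ip p_surj] := se.
have [C [c [c_surj cE]]] := quotient_exists (lin_image s).
have [|t tE] := @factor_surj R _ _ _ c (lin_comp p q) c_surj.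
  by move=> x /cE[y <-]; rewrite /= sE (short_exact_comp0 _ se).
have seC : short_exact (lin_comp c b) t.
  split.
  - apply: linear_inj => x /cE[y e]; have : i y = 0 by rewrite -sE e (short_exact_comp0 _ seE).
    move=> iy; have ey : y = 0 by apply: i_inj; rewrite iy linear0.
    by apply: b_inj; rewrite -e ey !linear0.
  - move=> z; split=> [|[y <-]]; last by rewrite /= tE /= (short_exact_comp0 _ seE) linear0.
    have [x <-] := c_surj z; rewrite tE => /ip[y e].
    have /bq[w ew] : q (x - s y) = 0 by rewrite linearB sE e subrr.
    by exists w; rewrite /= ew linearB (_ : c (s y) = 0) ?subr0 //; apply/cE; exists y.
  - by move=> a; have [x <-] := p_surj a; have [y <-] := q_surj x; exists (c y); rewrite tE.
have /Ext1P h := h''; have [r rK] := h _ _ _ seC.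
by exists (lin_comp r c) => x; rewrite -[RHS]rK.
Qed.

Definition free_cover A : {linear free_module R A -> A} := free_ext (fun a => a).

Lemma free_cover_surj A : surjective_map (free_cover A).
Proof. by move=> a; exists (delta a); rewrite free_ext_delta. Qed.

Definition syzygy A : lmodType R := sub_of (kernel (free_cover A)).
Definition syzygy_incl A : {linear syzygy A -> free_module R A} :=
  sub_incl (kernel (free_cover A)).

Lemma syzygy_exact A : short_exact (syzygy_incl A) (free_cover A).
Proof. exact/kernel_short_exact/free_cover_surj. Qed.

(** The vanishing of the extension group in degree [k + 1], not [k]. *)
Definition Ext_vanish k A Y := Ext1_eq0 (iter k syzygy A) Y.

Lemma Ext_vanishS k A Y : Ext_vanish k.+1 A Y = Ext_vanish k (syzygy A) Y.
Proof. by rewrite /Ext_vanish iterSr. Qed.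

Lemma zero_projective Z : zero_module Z -> projective_module Z.
Proof.
move=> z0 A B g f g_surj; have zL : linear (fun _ : Z => 0 : A).
  by move=> a u v; rewrite scaler0 addr0.
by exists (Lin zL) => x /=; rewrite (z0 x) !linear0.
Qed.

End Ext.

(** * Injective modules *)

Lemma Zorn_maximal (T : Type) (t0 : T) (le : T -> T -> Prop) :
  (forall t, le t t) -> (forall r s t, le r s -> le s t -> le r t) ->
  (forall A : T -> Prop, (exists t, A t) ->
     (forall s t, A s -> A t -> le s t \/ le t s) -> exists t, forall s, A s -> le s t) ->
  exists t, forall s, le t s -> le s t.
Proof.
move=> le_refl le_trans ub.
have [|r s t /asboolP h1 /asboolP h2|A totA|t tmax] :=
  @ZL_preorder T t0 (fun s t => `[< le s t >]).
- by move=> t; apply/asboolP.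
- by apply/asboolP; apply: le_trans h1 h2.
- have [[s As]|emptyA] := EM (exists s, A s); last first.
    by exists t0 => s As; case: emptyA; exists s.
  have [||t tP] := ub A; first by exists s.
    by move=> x y Ax Ay; have [/asboolP|/asboolP] := totA x y Ax Ay; [left|right].
  by exists t => x /tP/asboolP.
by exists t => s h; apply/asboolP/tmax/asboolP.
Qed.

Section Baer.
Variable R : pzRingType.
Implicit Types A B I : lmodType R.

Lemma chain_union_exists B (T : Type) (A : T -> Prop) (S : T -> submodule B) :
  (exists t, A t) ->
  (forall s t, A s -> A t -> (forall x, S s x -> S t x) \/ (forall x, S t x -> S s x)) ->
  exists U : submodule B, forall x, U x <-> exists t, A t /\ S t x.
Proof.
move=> [t0 At0] tot; pose P x := exists t, A t /\ S t x.
have P0 : P 0 by exists t0; split=> //; apply: smem0.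
have PP a u v : P u -> P v -> P (a *: u + v).
  move=> [s [As Su]] [t [At Sv]].
  by have [h|h] := tot s t As At; [exists t | exists s]; split=> //; apply: smemP => //; apply: h.
by exists (Submodule P0 PP).
Qed.

(** Partial extensions are represented by their graphs.  A maximal one is
    everywhere defined, because the hypothesis on ideals allows to enlarge it by
    any single element [b]: the ideal is that of the scalars [r] for which
    [r *: b] is already in the domain. *)
Lemma Baer I :
  (forall (J : submodule (R^o : lmodType R)) (f : {linear sub_of J -> I}),
     exists x, forall r, f r = (sub_val r : R) *: x) ->
  injective_module I.
Proof.
move=> baer A B i f i_inj.
pose functional (G : submodule (B * I)%type) := forall y, G (0, y) -> y = 0.
pose extends (G : submodule (B * I)%type) := forall a, G (i a, f a).
pose T := {G : submodule (B * I)%type | functional G /\ extends G}.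
pose le (G H : T) := forall z, (sval G) z -> (sval H) z.
have gL : linear (fun a => (i a, f a) : (B * I)%type) by move=> a u v; rewrite !linearP.
have G0P : functional (lin_image (Lin gL)) /\ extends (lin_image (Lin gL)).
  split=> [y [a /= [ia <-]]|a]; last by exists a.
  have -> : a = 0 by apply: i_inj; rewrite ia linear0.
  by rewrite linear0.
have [||C Cne totC|[G [funG extG]] maxG] := @Zorn_maximal T (exist _ _ G0P) le.
- by move=> G.
- by move=> G1 G2 G3 h12 h23 z /h12/h23.
- have [//|s t Cs Ct|U UP] := @chain_union_exists (B * I)%type T C (fun t => sval t).
    exact: totC.
  have [G CG] := Cne; have UG : functional U /\ extends U.
    split=> [y /UP[t [_ ht]]|a]; first by have [h _] := svalP t; apply: h.
    by apply/UP; exists G; split=> //; have [_ h] := svalP G; apply: h.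
  by exists (exist _ U UG) => s Cs z sz; apply/UP; exists s.
have fun2 b y y' : G (b, y) -> G (b, y') -> y = y'.
  move=> h h'; apply/subr0_eq/funG.
  by have := smemB h h'; rewrite -[_ - _]/(b - b, y - y') subrr.
have total b : exists y, G (b, y).
  have [J JP] : exists J : submodule (R^o : lmodType R),
      forall r : R, J r <-> exists y, G (r *: b, y).
    have P0 : exists y, G ((0 : R) *: b, y) by exists 0; rewrite scale0r; apply: smem0.
    have PP (a u v : R) : (exists y, G (u *: b, y)) -> (exists y, G (v *: b, y)) ->
        exists y, G ((a * u + v) *: b, y).
      move=> [y hy] [z hz]; exists (a *: y + z); have := smemP a hy hz.
      by rewrite scalerDl -scalerA.
    by exists (@Submodule R (R^o : lmodType R) (fun r => exists y, G ((r : R) *: b, y)) P0 PP).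
  have val_J (r : sub_of J) : J (sub_val r) := sub_valS r.
  have [h hP] := choice (fun r : sub_of J => (JP (sub_val r)).1 (val_J r)).
  have hL : linear h.
    move=> a u v; apply: (fun2 _ _ _ (hP _)).
    have := smemP a (hP u) (hP v).
    by rewrite -[_ + _]/(a *: ((sub_val u : R) *: b) + _, _) scalerA -scalerDl.
  have [x xP] := baer J (Lin hL).
  have lL : linear (fun r : R^o => ((r : R) *: b, (r : R) *: x) : (B * I)%type).
    move=> a u v; rewrite -[RHS]/(_ + _, _ + _) /= !scalerA.
    by rewrite -!scalerDl.
  pose P z := exists2 g, G g & exists r : R, z = g + (r *: b, r *: x).
  have P0 : P 0 by exists 0; [exact: smem0 | exists 0; rewrite !scale0r addr0].
  have PP a u v : P u -> P v -> P (a *: u + v).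
    move=> [g Gg [r ->]] [g' Gg' [r' ->]]; exists (a *: g + g'); first exact: smemP.
    exists (a * r + r'); have /= -> := lL a r r'.
    by rewrite scalerDr addrACA.
  have funH : functional (Submodule P0 PP).
    move=> y [[g1 g2] Gg [r]] -[/esym e ->].
    have Jr : J r by apply/JP; exists (- g2); move: Gg => /smemN; rewrite -[- _]/(- g1, - g2) -(addr0_eq e) //.
    have [r' er'] := (sub_inclP J r).1 Jr.
    have := hP r'; have /= -> := xP r'; rewrite -[sub_val r']/(sub_incl J r') er'.
    move=> /(smemD Gg); rewrite -[_ + _]/(g1 + _, g2 + _) e; exact: funG.
  have extH : extends (Submodule P0 PP).
    by move=> a; exists (i a, f a); [exact: extG | exists 0; rewrite !scale0r addr0].
  exists x; apply: (maxG (exist _ (Submodule P0 PP) (conj funH extH))).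
    by move=> z Gz; exists z => //; exists 0; rewrite !scale0r addr0.
  by exists 0; [exact: smem0 | exists 1; rewrite !scale1r add0r].
have [h hP] := choice total.
have hL : linear h by move=> a u v; apply: (fun2 _ _ _ (hP _)); apply: (smemP a (hP u) (hP v)).
by exists (Lin hL) => a; apply: (fun2 _ _ _ (hP _)).
Qed.

End Baer.

(** Over the integers, divisible modules are injective because every ideal is
    principal. *)
Lemma divisible_injective (D : lmodType int) :
  (forall (n : int) (y : D), n != 0 -> exists x, n *: x = y) -> injective_module D.
Proof.
move=> div; apply: Baer => J f.
have val_J (r : sub_of J) : J (sub_val r) := sub_valS r.
have [/asboolP ex|no] := boolP `[< exists n : nat, (0 < n)%N && `[< J n%:Z >] >]; last first.
  exists 0 => r; rewrite scaler0.
  have -> : r = 0; last by rewrite linear0.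
  apply: val_inj; apply/eqP/negPn/negP => r0; case/negP: no; apply/asboolP.
  exists `|(sub_val r : int)|%N; rewrite absz_gt0 [X in X && _]r0; apply/asboolP.
  have := val_J r; case: (intP (sub_val r : int)) r0 => [|n|n] // _.
  by move/smemN; rewrite opprK.
have [n /andP[n_gt0 /asboolP Jn] n_min] := ex_minnP ex.
have [rn ern] := (sub_inclP J _).1 Jn.
have n0 : n%:Z != 0 by rewrite eqz_nat -lt0n.
have [x xP] := div n%:Z (f rn) n0.
exists x => r; have := val_J r; set z : int := sub_val r => Jz.
have Jm : J (z %% n)%Z.
  have -> : (z %% n)%Z = (- (z %/ n)%Z) *: (n%:Z : int^o) + z.
    by rewrite /modz addrC; congr (_ + _); rewrite -mulNr.
  exact: smemP.
have m0 : (z %% n)%Z = 0.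
  have := ltz_pmod z (n_gt0 : 0 < n%:Z); have := modz_ge0 z n0.
  case: (z %% n)%Z Jm => // m Jm _; rewrite ltz_nat => m_lt.
  have [->|m_gt0] := posnP m; first by [].
  by have := n_min m; rewrite m_gt0 asboolT // => /(_ isT); rewrite leqNgt m_lt.
have ez : z = (z %/ n)%Z * n by rewrite {1}(divz_eq z n) m0 addr0.
have -> : r = (z %/ n)%Z *: rn.
  apply: (@sub_incl_inj _ _ J); rewrite linearZ /= -[sub_val rn]/(sub_incl J rn) ern.
  exact: ez.
rewrite linearZ -xP [LHS]scalerA; congr (_ *: _); exact/esym.
Qed.

(** Every abelian group [A] is the quotient of the free abelian group on its
    elements by the group of relations; dividing the rational vector space on
    these elements by the same relations gives a divisible group containing [A]. *)
Lemma divisible_embedding (A : zmodType) :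
  exists (D : lmodType int) (j : A -> D),
    [/\ forall n (y : D), n != 0 -> exists x, n *: x = y,
        forall x y, j (x + y) = j x + j y & forall x, j x = 0 -> x = 0].
Proof.
pose F := zmodule (free_module rat A).
pose ev : {linear free_module int A -> zmodule A} := free_ext (fun a : A => a : zmodule A).
pose P (c : F) := exists c0, ev c0 = 0 /\ forall b, coeff (c : free_module rat A) b = (coeff c0 b)%:~R.
have P0 : P 0 by exists 0; split=> [|b]; rewrite ?linear0.
have PP a u v : P u -> P v -> P (a *: u + v).
  move=> [u0 [eu hu]] [v0 [ev0 hv]]; exists (a *: u0 + v0); split.
    by rewrite linearP eu ev0 scaler0 addr0.
  move=> b; rewrite coeffP rmorphD rmorphM /= -hu -hv.
  rewrite -[LHS]/(coeff ((u : free_module rat A) *~ a + (v : free_module rat A)) b).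
  by rewrite coeffD -scaler_int coeffZ.
have [D [p [p_surj pP]]] := quotient_exists (Submodule P0 PP).
exists D, (fun a => p (delta a : F)); split.
- move=> n y n0; have [c <-] := p_surj y.
  exists (p ((n%:~R : rat)^-1 *: (c : free_module rat A) : free_module rat A)).
  rewrite -linearZ; congr (p _); rewrite scalezrE.
  by rewrite -scaler_int scalerA divff ?scale1r // intr_eq0.
- move=> x y; apply/esym/subr0_eq; rewrite -linearD -linearB; apply/pP.
  exists (delta x + delta y - delta (x + y)); split.
    by rewrite !linearB !linearD /ev !free_ext_delta subrr.
  move=> b; rewrite -[coeff (delta x + delta y - delta (x + y) : free_module int A) b]/(coeff _ _ + coeff _ _ - coeff _ _).
  rewrite -[LHS]/(coeff (delta x) b + coeff (delta y) b - coeff (delta (x + y)) b).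
  by rewrite !coeff_delta; do 3!case: asboolP.
- move=> x /pP[c0 [e h]]; have ec : c0 = delta x.
    apply: coeff_inj => b; apply: (@intr_inj rat); rewrite -h !coeff_delta.
    by case: asboolP.
  by move: e; rewrite ec /ev free_ext_delta.
Qed.

Section Coinduction.
Variables (R : pzRingType) (D : lmodType int).

Fact additive_fun_subproof a (f g : R -> D) :
  (forall x y, f (x + y) = f x + f y) -> (forall x y, g (x + y) = g x + g y) ->
  forall x y, (a *: f + g) (x + y) = (a *: f + g) x + (a *: f + g) y.
Proof. by move=> hf hg x y; rewrite !fctE hf hg scalerDr addrACA. Qed.

Fact additive_fun_subproof0 (x y : R) : (0 : R -> D) (x + y) = (0 : R -> D) x + (0 : R -> D) y.
Proof. by rewrite addr0. Qed.

Definition additive_fun : submodule (R -> D) :=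
  @Submodule int (R -> D) (fun f => forall x y, f (x + y) = f x + f y)
    additive_fun_subproof0 additive_fun_subproof.

(** The action is through right multiplication in [R]. *)
Definition coinduced := sub_of additive_fun.

HB.instance Definition _ := GRing.Zmodule.on coinduced.

Fact coinduced_additive (f : coinduced) x y : sub_val f (x + y) = sub_val f x + sub_val f y.
Proof. exact: (sub_valS f). Qed.

Fact coinduced_scale_subproof a (f : coinduced) :
  additive_fun (fun r => sub_val f (r * a)).
Proof. by move=> x y; rewrite mulrDl coinduced_additive. Qed.

Definition coinduced_scale a (f : coinduced) : coinduced :=
  SubOf (asboolT (coinduced_scale_subproof a f)).

Fact coinduced_scaleA a b f :
  coinduced_scale a (coinduced_scale b f) = coinduced_scale (a * b) f.
Proof. by apply/val_inj/funext => r /=; rewrite mulrA. Qed.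
Fact coinduced_scale1 : left_id 1 coinduced_scale.
Proof. by move=> f; apply/val_inj/funext => r /=; rewrite mulr1. Qed.
Fact coinduced_scaleDr : right_distributive coinduced_scale +%R.
Proof. by move=> a f g; apply/val_inj/funext. Qed.
Fact coinduced_scaleDl f : {morph coinduced_scale^~ f : a b / a + b}.
Proof. by move=> a b; apply/val_inj/funext => r /=; rewrite mulrDr coinduced_additive. Qed.

HB.instance Definition _ := GRing.Zmodule_isLmodule.Build R coinduced
  coinduced_scaleA coinduced_scale1 coinduced_scaleDr coinduced_scaleDl.

End Coinduction.

Lemma additive_int_linear (M N : lmodType int) (h : M -> N) :
  (forall x y, h (x + y) = h x + h y) -> linear h.
Proof.
move=> hD; have h0 : h 0 = 0 by apply: (addrI (h 0)); rewrite -hD !addr0.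
have hB x y : h (x - y) = h x - h y by apply/eqP; rewrite eq_sym subr_eq -hD subrK.
pose ha : {additive M -> N} := HB.pack h (GRing.isZmodMorphism.Build M N h hB).
have scz (L : lmodType int) (a : int) (x : L) : a *: x = x *~ a.
  by rewrite -scaler_int intz.
by move=> a u v; rewrite hD !scz -(raddfMz ha).
Qed.

(** Coinduction is right adjoint to the restriction of scalars, which preserves
    injective maps. *)
Lemma coinduced_injective (R : pzRingType) (D : lmodType int) :
  injective_module D -> injective_module (coinduced R D : lmodType R).
Proof.
move=> injD A B i f i_inj.
have ziL : linear (i : zmodule A -> zmodule B).
  by apply: additive_int_linear => x y; apply: (linearD i).
have fL : linear ((fun a => sub_val (f a) 1) : zmodule A -> D).
  by apply: additive_int_linear => x y; rewrite linearD.
have [g gE] := injD _ _ (Lin ziL) (Lin fL) i_inj.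
have gD b : additive_fun R D (fun r => g (r *: b : B)).
  by move=> x y; rewrite scalerDl; apply: (linearD g).
have hL : linear (fun b => SubOf (asboolT (gD b)) : coinduced R D).
  move=> a u v; apply/val_inj/funext => r /=.
  by rewrite scalerDr scalerA; apply: (linearD g).
exists (Lin hL) => a; apply/val_inj/funext => r /=.
by rewrite -linearZ; have /= -> := gE (r *: a); rewrite linearZ /= mul1r.
Qed.

Section EnoughInjectives.
Variable R : pzRingType.
Implicit Types A C I K P X Y : lmodType R.

(** [X] embeds in the coinduced module of a divisible group containing it, by
    sending [x] to the map that takes [r] to [r *: x]. *)
Lemma enough_injectives X :
  exists I (j : {linear X -> I}), injective_module I /\ injective j.
Proof.
have [D [j [divD jD j0]]] := divisible_embedding X.
have addj x : additive_fun R D (fun r => j (r *: x)).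
  by move=> r s; rewrite scalerDl jD.
have hL : linear (fun x => SubOf (asboolT (addj x)) : coinduced R D).
  move=> a u v; apply/val_inj/funext => r /=.
  by rewrite scalerDr scalerA; apply: jD.
exists (coinduced R D), (Lin hL); split.
  exact/coinduced_injective/divisible_injective.
apply: linear_inj => x /(congr1 (fun h => sub_val h 1)) /=; rewrite scale1r.
exact: j0.
Qed.

(** A record, so that a copresentation can be chosen for each module and the
    cosyzygy becomes a function. *)
Record injective_copresentation Y := InjectiveCopresentation {
  cop_mid : lmodType R;
  cosyzygy : lmodType R;
  cop_in : {linear Y -> cop_mid};
  cop_out : {linear cop_mid -> cosyzygy};
  cop_injective : injective_module cop_mid;
  cop_exact : short_exact cop_in cop_out }.

Arguments cop_injective : clear implicits.
Arguments cop_injective {Y} _.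

Fact copresentation_exists Y : exists c : injective_copresentation Y, True.
Proof.
have [I [j [injI /cokernel_exists[C [g se]]]]] := enough_injectives Y.
by exists (InjectiveCopresentation injI se).
Qed.

Definition copresentation Y := projT1 (cid (copresentation_exists Y)).

Definition cosyz Y : lmodType R := cosyzygy (copresentation Y).

(** Extension groups are defined by syzygies of the first argument; this and the
    next lemma compute them by cosyzygies of the second. *)
Lemma Ext_vanish_cosyz k A Y : Ext_vanish k A (cosyz Y) <-> Ext_vanish k.+1 A Y.
Proof.
have shift := dimension_shift (syzygy_exact (iter k (@syzygy R) A))
  (cop_exact (copresentation Y)) (@free_projective _ _) (cop_injective _).
by split=> h; apply/shift.
Qed.

Lemma Ext_vanish_iter k A Y : Ext_vanish k A Y <-> Ext1_eq0 A (iter k cosyz Y).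
Proof.
elim: k Y => // k IH Y; rewrite iterSr -IH.
by split=> /Ext_vanish_cosyz.
Qed.

Lemma Ext_vanish_presentation k K P A Y (i : {linear K -> P}) (p : {linear P -> A}) :
  short_exact i p -> projective_module P ->
  Ext_vanish k K Y <-> Ext_vanish k.+1 A Y.
Proof.
move=> se pP; rewrite !Ext_vanish_iter iterS.
exact: dimension_shift se (cop_exact _) pP (cop_injective _).
Qed.

Lemma Ext_vanish_copresentation k A Y I C (i : {linear Y -> I}) (p : {linear I -> C}) :
  short_exact i p -> injective_module I ->
  Ext_vanish k A C <-> Ext_vanish k.+1 A Y.
Proof.
move=> se iI; have shift := dimension_shift (syzygy_exact (iter k (@syzygy R) A)) se
  (@free_projective _ _) iI.
by split=> h; apply/shift.
Qed.

Lemma Ext_vanish_projective k P Y : projective_module P -> Ext_vanish k P Y.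
Proof. by move=> pP; apply/Ext_vanish_iter/projective_Ext1. Qed.

Lemma Ext_vanish_middle k A' A A'' Y (i : {linear A' -> A}) (p : {linear A -> A''}) :
  short_exact i p -> Ext_vanish k A' Y -> Ext_vanish k A'' Y -> Ext_vanish k A Y.
Proof. by move=> se; rewrite !Ext_vanish_iter; apply: Ext1_middle se. Qed.

(** With [Ext_vanish_middle], this and the next lemma are the consequences of
    the long exact sequence in the first argument. *)
Lemma Ext_vanish_right k A' A A'' Y (i : {linear A' -> A}) (p : {linear A -> A''}) :
  short_exact i p -> Ext_vanish k A' Y -> Ext_vanish k.+1 A Y -> Ext_vanish k.+1 A'' Y.
Proof.
move=> se; rewrite !Ext_vanish_iter iterS; set V := iter k _ _ => h' h.
apply: (Ext1_of_extend se h) => f.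
have [g gE] := Ext1_lift f (cop_exact (copresentation V)) h'; have [i_inj _ _] := se.
have [g' g'E] := cop_injective (copresentation V) _ _ i g i_inj.
by exists (lin_comp (cop_out (copresentation V)) g') => x; rewrite /= g'E.
Qed.

Lemma Ext_vanish_left k A' A A'' Y (i : {linear A' -> A}) (p : {linear A -> A''}) :
  short_exact i p -> Ext_vanish k A Y -> Ext_vanish k.+1 A'' Y -> Ext_vanish k A' Y.
Proof.
move=> se; rewrite !Ext_vanish_iter iterS; set V := iter k _ _ => h h''.
apply: (Ext1_of_lift (cop_exact (copresentation V))); first exact/injective_Ext1/cop_injective.
move=> f; have [g gE] := Ext1_extend f se h''.
have [g' g'E] := Ext1_lift g (cop_exact (copresentation V)) h.
by exists (lin_comp g' i) => x; rewrite /= g'E.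
Qed.

End EnoughInjectives.

(** * The small object argument *)

(** The right lifting property of [p] with respect to [i]. *)
Definition has_rlp (R : pzRingType) (K F E A : lmodType R)
    (i : {linear K -> F}) (p : {linear E -> A}) :=
  forall (h : {linear K -> E}) (w : {linear F -> A}), (forall k, p (h k) = w (i k)) ->
  exists l : {linear F -> E}, (forall k, l (i k) = h k) /\ (forall v, p (l v) = w v).

Section SmallObject.
Variables (R : pzRingType) (X : lmodType R) (I : Type).
Variables (K F : I -> lmodType R) (iota : forall i, {linear K i -> F i}).

(** [Op f v] stands for the value at [v] of a chosen extension along [iota i] of
    the map [f].  The operation is total, but only for linear [f] does the
    congruence below make its values linear in [v] and an extension of [f]. *)
Inductive term : Type :=
  | Var of X
  | Add of term & term
  | Scale of R & term
  | Op (i : I) of (K i -> term) & F i.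

Inductive teq : term -> term -> Prop :=
  | teq_refl t : teq t t
  | teq_sym t t' : teq t t' -> teq t' t
  | teq_trans t t' t'' : teq t t' -> teq t' t'' -> teq t t''
  | teq_Add s s' t t' : teq s s' -> teq t t' -> teq (Add s t) (Add s' t')
  | teq_Scale a t t' : teq t t' -> teq (Scale a t) (Scale a t')
  | teq_Op i (f g : K i -> term) v : (forall k, teq (f k) (g k)) -> teq (Op f v) (Op g v)
  | teq_addA s t u : teq (Add s (Add t u)) (Add (Add s t) u)
  | teq_addC s t : teq (Add s t) (Add t s)
  | teq_add0 t : teq (Add (Var 0) t) t
  | teq_scaleA a b t : teq (Scale a (Scale b t)) (Scale (a * b) t)
  | teq_scale1 t : teq (Scale 1 t) t
  | teq_scale0 t : teq (Scale 0 t) (Var 0)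
  | teq_scaleDr a s t : teq (Scale a (Add s t)) (Add (Scale a s) (Scale a t))
  | teq_scaleDl a b t : teq (Scale (a + b) t) (Add (Scale a t) (Scale b t))
  | teq_Var a x y : teq (Var (a *: x + y)) (Add (Scale a (Var x)) (Var y))
  (* The premise, linearity of [f] modulo the congruence, occurs positively. *)
  | teq_Op_linear i (f : K i -> term) a u v :
      (forall b k k', teq (f (b *: k + k')) (Add (Scale b (f k)) (f k'))) ->
      teq (Op f (a *: u + v)) (Add (Scale a (Op f u)) (Op f v))
  | teq_Op_extends i (f : K i -> term) k :
      (forall b k k', teq (f (b *: k + k')) (Add (Scale b (f k)) (f k'))) ->
      teq (Op f (iota i k)) (f k).

Section Evaluation.
Variables (B E A : lmodType R) (c : term -> B).
Hypothesis c_teq : forall s t, c s = c t <-> teq s t.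
Hypothesis cD : forall s t, c (Add s t) = c s + c t.
Hypothesis cZ : forall a t, c (Scale a t) = a *: c t.
Variables (p : {linear E -> A}) (x0 : {linear X -> E}) (q : {linear B -> A}).
Hypothesis p_surj : surjective_map p.
Hypothesis p_rlp : forall i, has_rlp (iota i) p.
Hypothesis px0 : forall x, p (x0 x) = q (c (Var x)).

(** An interpretation of the operations in [E], over their interpretation [w] in
    [A]: the lifting property when the data are linear, and any lift otherwise. *)
Fact solution_exists i (h : K i -> E) (w : F i -> A) :
  exists l : F i -> E, (forall v, p (l v) = w v) /\
    (linear h -> linear w -> (forall k, p (h k) = w (iota i k)) ->
     linear l /\ forall k, l (iota i k) = h k).
Proof.
have [[hL [wL e]]|no] := EM (linear h /\ linear w /\ forall k, p (h k) = w (iota i k)).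
  have [l [l1 l2]] := @p_rlp i (Lin hL) (Lin wL) e.
  by exists l; split=> // _ _ _; split=> //; apply: linearP.
have [s sK] := choice p_surj.
by exists (s \o w); split=> [v|? ? ?]; [exact: sK | case: no].
Qed.

Definition solution i (h : K i -> E) (w : F i -> A) : F i -> E :=
  projT1 (cid (solution_exists h w)).

Fixpoint eval (t : term) : E :=
  match t with
  | Var x => x0 x
  | Add s t => eval s + eval t
  | Scale a t => a *: eval t
  | Op i f v => solution (fun k => eval (f k)) (fun v => q (c (Op f v))) v
  end.


Lemma eval_over t : p (eval t) = q (c t).
Proof.
elim: t => [x|s IHs t IHt|a t IHt|i f _ v] /=; first exact: px0.
- by rewrite linearD IHs IHt cD linearD.
- by rewrite linearZ IHt cZ linearZ.
- by rewrite /solution; case: cid => l [].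
Qed.

(** By induction on the congruence.  The premise of the two last rules makes the
    evaluation of [f] linear, so that the interpretation of [Op f] is a solution
    of the lifting problem. *)
Lemma eval_teq s t : teq s t -> eval s = eval t.
Proof.
have solves i (f : K i -> term) :
    (forall b k k', teq (f (b *: k + k')) (Add (Scale b (f k)) (f k'))) ->
    (forall b k k', eval (f (b *: k + k')) = eval (Add (Scale b (f k)) (f k'))) ->
    linear (fun v => eval (Op f v)) /\ forall k, eval (Op f (iota i k)) = eval (f k).
  move=> fL efL; rewrite /= /solution; case: cid => l /= [_]; apply.
  - exact: efL.
  - move=> a u v; have /c_teq -> := teq_Op_linear a u v fL.
    by rewrite cD cZ linearP.
  - by move=> k; rewrite eval_over; congr (q _); apply/esym/c_teq/teq_Op_extends.
elim=> {s t} //.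
- by move=> t t' t'' _ -> _ ->.
- by move=> s s' t t' _ /= -> _ ->.
- by move=> a t t' _ /= ->.
- move=> i f g v fg IH /=.
  have -> : (fun k => eval (f k)) = (fun k => eval (g k)) by apply/funext.
  by congr (solution _ _ v); apply/funext => u; congr (q _); apply/c_teq/teq_Op.
- by move=> s t u /=; rewrite addrA.
- by move=> s t /=; rewrite addrC.
- by move=> t /=; rewrite linear0 add0r.
- by move=> a b t /=; rewrite scalerA.
- by move=> t /=; rewrite scale1r.
- by move=> t /=; rewrite scale0r linear0.
- by move=> a s t /=; rewrite scalerDr.
- by move=> a b t /=; rewrite scalerDl.
- by move=> a x y /=; rewrite linearP.
- by move=> i f a u v fL IH; have [h _] := solves i f fL IH; apply: h.
- by move=> i f k fL IH; have [_ h] := solves i f fL IH; apply: h.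
Qed.

Hypothesis c_surj : forall u, exists t, c t = u.

Lemma evaluation :
  exists u : {linear B -> E}, (forall x, u (c (Var x)) = x0 x) /\ (forall b, p (u b) = q b).
Proof.
have [r rK] := choice c_surj.
have uc t : eval (r (c t)) = eval t by apply/eval_teq/c_teq; rewrite rK.
have uL : linear (fun b => eval (r b)).
  move=> a u v; rewrite -[RHS]/(eval (Add (Scale a (r u)) (r v))) -[RHS]uc.
  by rewrite cD cZ !rK.
exists (Lin uL); split=> [x|b] /=; first by rewrite uc.
by rewrite eval_over rK.
Qed.

End Evaluation.

(** The quotient [B] of the terms solves all extension problems by construction,
    and evaluation of terms is its lifting property. *)
Theorem small_object :
  exists (B : lmodType R) (j : {linear X -> B}),
    (forall i (h : {linear K i -> B}), exists l : {linear F i -> B}, forall k, l (iota i k) = h k) /\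
    (forall (E A : lmodType R) (p : {linear E -> A}) (x0 : {linear X -> E}) (q : {linear B -> A}),
       surjective_map p -> (forall i, has_rlp (iota i) p) -> (forall x, p (x0 x) = q (j x)) ->
       exists u : {linear B -> E}, (forall x, u (j x) = x0 x) /\ (forall b, p (u b) = q b)).
Proof.
have [B [c [c_surj c_teq cD cZ]]] := setoid_module_exists teq_refl teq_sym teq_trans
  teq_Add teq_Scale teq_addA teq_addC teq_add0 teq_scaleA teq_scale1 teq_scale0
  teq_scaleDr teq_scaleDl.
have jL : linear (fun x => c (Var x)).
  by move=> a x y; rewrite -cZ -cD; apply/c_teq/teq_Var.
exists B, (Lin jL); split=> [i h|E A p x0 q p_surj p_rlp e]; last first.
  exact: (evaluation c_teq cD cZ p_surj p_rlp e c_surj).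
have [f fK] := choice (fun k => c_surj (h k)).
have fL b k k' : teq (f (b *: k + k')) (Add (Scale b (f k)) (f k')).
  by apply/c_teq; rewrite cD cZ !fK linearP.
have lL : linear (fun v => c (Op f v)).
  by move=> a u v; rewrite -cZ -cD; apply/c_teq/teq_Op_linear.
by exists (Lin lL) => k /=; rewrite -fK; apply/c_teq/teq_Op_extends.
Qed.

End SmallObject.

(** * Complete cotorsion pairs generated by small modules *)

Section Small.
Variable R : pzRingType.
Implicit Types A B C M X Y : lmodType R.

(** The type of codes is the measure of size: it is at least as large as [R] and
    closed under finite linear combinations and countable indexing. *)
Inductive code : Type := Node of nat & seq (R * code).

Fixpoint decode (T : Type) (step : nat -> seq (R * T) -> T) (x : code) : T :=
  let: Node n s := x in step n (map (fun rx => (rx.1, decode step rx.2)) s).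

(** A set generated by operations with finitely many arguments, coefficients in
    [R] and an index in [nat], is the set of values of [decode]. *)
Lemma decode_closed (T : Type) (step : nat -> seq (R * T) -> T) n (s : seq (R * T)) :
  (forall i, (i < size s)%N -> exists x, decode step x = (nth (0, decode step (Node 0 [::])) s i).2) ->
  exists x, decode step x = step n s.
Proof.
move=> h; have [s' es] : exists s', map (fun rx => (rx.1, decode step rx.2)) s' = s.
  elim: s h => [|[r t] s IH] h; first by exists [::].
  have [x ex] := h 0%N isT; have [|s' es] := IH; first by move=> i lti; apply: (h i.+1).
  by exists ((r, x) :: s'); rewrite /= es ex.
by exists (Node n s'); rewrite /= es.
Qed.

(** A bound on the cardinality, which makes the isomorphism classes a set. *)
Definition small A := exists g : code -> A, forall a, exists x, g x = a.

Lemma small_ring : small (R^o : lmodType R).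
Proof.
exists (fun x => if x is Node _ ((r, _) :: _) then r else 0) => r.
by exists (Node 0 [:: (r, Node 0 [::])]).
Qed.

Lemma small_quotient A B (p : {linear A -> B}) : surjective_map p -> small A -> small B.
Proof.
move=> p_surj [g gP]; exists (p \o g) => b.
by have [a <-] := p_surj b; have [x <-] := gP a; exists x.
Qed.

Lemma small_sub A B (i : {linear A -> B}) : injective i -> small B -> small A.
Proof.
move=> i_inj [g gP].
have [h hP] : {h : B -> A & forall b, (exists a, i a = b) -> i (h b) = b}.
  apply: (choice (P := fun b a => (exists a', i a' = b) -> i a = b)) => b.
  have [[a ea]|no] := EM (exists a, i a = b); first by exists a.
  by exists 0 => h; case: no.
exists (h \o g) => a; have [x ex] := gP (i a); exists x.
by apply: i_inj; rewrite /= ex hP //; exists a.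
Qed.

Lemma small_free (T : Type) (g : code -> T) :
  (forall t, exists x, g x = t) -> small (free_module R T).
Proof.
move=> gP; have [h hK] := choice gP.
exists (fun x => let: Node _ s := x in \sum_(rx <- s) rx.1 *: delta (g rx.2)) => u.
exists (Node 0 [seq (coeff u t, h t) | t <- supp u]).
rewrite big_map /= [RHS]free_expand; apply: eq_bigr => t _.
by rewrite hK.
Qed.

Lemma small_syzygy A : small A -> small (syzygy A).
Proof. by move=> [g gP]; apply: (small_sub (@sub_incl_inj _ _ _)); apply: small_free gP. Qed.

Lemma small_iter_syzygy k A : small A -> small (iter k (@syzygy R) A).
Proof. by elim: k => // k IH /IH; apply: small_syzygy. Qed.

Lemma small_cover A : small A -> exists p : {linear free_module R code -> A}, surjective_map p.
Proof.
move=> [g gP]; exists (free_ext g) => a; have [x <-] := gP a.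
by exists (delta x); rewrite free_ext_delta.
Qed.

Definition small_orth (F : module_class R) : module_class R :=
  right_orth (fun A => F A /\ small A).

(** The small members of [F] are, up to isomorphism, the quotients of one free
    module [Phi], so the inclusions in [Phi] of the kernels form a family to
    which [small_object] applies.  Lifting against an embedding of [X] in an
    injective module makes [j] injective; lifting the zero map of [X] against an
    extension [p] of the cokernel [A] gives a section of [p]. *)
Theorem small_orth_preenvelope (F : module_class R) X :
  exists B A (j : {linear X -> B}) (q : {linear B -> A}),
    [/\ short_exact j q, small_orth F B & left_orth (small_orth F) A].
Proof.
pose Phi := free_module R code.
pose idx := {L : submodule Phi | exists (A : lmodType R) (p : {linear Phi -> A}),
   [/\ F A, small A, surjective_map p & forall x, p x = 0 <-> L x]}.
pose K (L : idx) : lmodType R := sub_of (sval L).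
pose iota (L : idx) : {linear K L -> Phi} := sub_incl (sval L).
have iota_exact (L : idx) : exists (A : lmodType R) (p : {linear Phi -> A}),
    [/\ F A, small A & short_exact (iota L) p].
  have [A [p [FA sA p_surj pL]]] := svalP L; exists A, p; split=> //; split=> //.
    exact: sub_incl_inj.
  by move=> y; rewrite pL; exact: sub_inclP.
have proj_Phi : projective_module Phi := @free_projective R code.
have orth_extend Y (L : idx) (h : {linear K L -> Y}) : small_orth F Y ->
    exists l : {linear Phi -> Y}, forall k, l (iota L k) = h k.
  move=> oY; have [A [p [FA sA se]]] := iota_exact L.
  by apply: Ext1_extend se _; apply: oY.
have [B [j [ext lifting]]] := @small_object R X idx K (fun _ => Phi) iota.
have orthB : small_orth F B.
  move=> A [FA sA]; have [p p_surj] := small_cover sA.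
  have se := kernel_short_exact p_surj.
  have LP : exists (A : lmodType R) (p0 : {linear Phi -> A}),
      [/\ F A, small A, surjective_map p0 & forall x, p0 x = 0 <-> kernel p x].
    by exists A, p.
  apply: (Ext1_of_extend se); first exact: projective_Ext1.
  by move=> f; apply: (ext (exist _ (kernel p) LP) f).
have j_inj : injective j.
  have [J [a [injJ a_inj]]] := enough_injectives X.
  have zL (M : lmodType R) : linear (fun _ : M => 0 : 'rV[R]_0).
    by move=> r u v; rewrite scaler0 addr0.
  have [||//|u [uj _]] := lifting J 'rV[R]_0 (Lin (zL J)) a (Lin (zL B)).
  - by move=> y; exists 0; apply/rowP => -[].
  - move=> L h w _; have [_ [_ [_ _ [iota_inj _ _]]]] := iota_exact L.
    have [l lE] := injJ _ _ _ h iota_inj.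
    by exists l; split=> // v; apply/rowP => -[].
  by move=> x y e; apply: a_inj; rewrite -!uj e.
have [A [q se]] := cokernel_exists j_inj.
exists B, A, j, q; split=> // Y oY; apply/Ext1P => E a p seE.
have [a_inj ap p_surj] := seE; have [_ jq q_surj] := se.
have zL : linear (fun _ : X => 0 : E) by move=> r u v; rewrite scaler0 addr0.
have [//||x|u [uj pu]] := lifting E A p (Lin zL) q.
- move=> L h w e; have [l0 l0E] := proj_Phi _ _ p w p_surj.
  have [|d dE] := @factor_inj R _ _ _ a (sub_lin h (lin_comp l0 (iota L))) a_inj.
    by move=> k; apply/ap; rewrite /= linearB e l0E subrr.
  have [d' d'E] := orth_extend _ _ d oY.
  have lL : linear (fun v => l0 v + a (d' v)).
    by move=> r u v; rewrite !linearP addrACA scalerDr.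
  exists (Lin lL); split=> [k|v] /=; first by rewrite d'E dE /= addrC subrK.
  by rewrite linearD l0E (short_exact_comp0 _ seE) addr0.
- by rewrite (short_exact_comp0 _ se) linear0.
have [|s sE] := @factor_surj R _ _ _ q u q_surj.
  by move=> b /jq[x <-]; rewrite uj.
apply: (retraction_of_section (s := s) seE) => y.
by have [b <-] := q_surj y; rewrite sE pu.
Qed.

End Small.

(** * Resolutions by finitely generated free modules *)

Section RowModules.
Variable R : pzRingType.
Implicit Types M : lmodType R.

Lemma row_map_linear M n (x : 'I_n -> M) :
  linear (fun u : 'rV[R]_n => \sum_i u 0 i *: x i).
Proof.
move=> a u v; rewrite scaler_sumr -big_split; apply: eq_bigr => i _ /=.
by rewrite !mxE scalerDl scalerA.
Qed.

Definition row_map M n (x : 'I_n -> M) : {linear 'rV[R]_n -> M} := Lin (row_map_linear x).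

Lemma row_map_delta M n (x : 'I_n -> M) i : row_map x (delta_mx 0 i) = x i.
Proof.
rewrite /= (bigD1 i) //= big1 ?addr0 => [|j /negPf ji]; first by rewrite mxE !eqxx scale1r.
by rewrite mxE ji andbF scale0r.
Qed.

Lemma row_linear_eq M n (f g : {linear 'rV[R]_n -> M}) :
  (forall i, f (delta_mx 0 i) = g (delta_mx 0 i)) -> f =1 g.
Proof.
move=> h u; rewrite [u]row_sum_delta !linear_sum; apply: eq_bigr => i _.
by rewrite !linearZ h.
Qed.

Lemma row_projective n : projective_module ('rV[R]_n : lmodType R).
Proof.
move=> A B g f g_surj; have [x xE] := choice (fun i => g_surj (f (delta_mx 0 i))).
exists (row_map x); apply: (row_linear_eq (f := lin_comp g (row_map x))) => i.
by rewrite -xE -[in RHS](row_map_delta x i).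
Qed.

Lemma mulmx_linear m n (D : 'M[R]_(m, n)) : linear (fun u : 'rV[R]_m => u *m D).
Proof. by move=> a u v; rewrite mulmxDl scalemxAl. Qed.

Definition mul_by m n (D : 'M[R]_(m, n)) : {linear 'rV[R]_m -> 'rV[R]_n} := Lin (mulmx_linear D).

Lemma submodule_rows m n (P : submodule ('rV[R]_n : lmodType R)) (A : 'M[R]_(m, n)) (u : 'rV[R]_m) :
  (forall i, P (row i A)) -> P (u *m A).
Proof. by move=> h; rewrite mulmx_sum_row; apply: smem_sum => i; apply: smemZ. Qed.

Hypothesis noethR : noetherian_module (R^o : lmodType R).

(** Otherwise one could add generators to the empty list for ever. *)
Lemma noetherian_ideal (J : submodule (R^o : lmodType R)) :
  exists m (A : 'cV[R]_m), forall r : R, J r <-> exists u : 'rV_m, r = (u *m A) 0 0.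
Proof.
pose T := {m : nat & {A : 'cV[R]_m | forall u : 'rV_m, J ((u *m A) 0 0)}}.
pose Span (t : T) (r : R) := exists u : 'rV_(projT1 t), r = (u *m sval (projT2 t)) 0 0.
have Span_J t r : Span t r -> J r by case=> u ->; apply: (svalP (projT2 t)).
have [[t ht]|no] := EM (exists t : T, forall r, J r -> Span t r).
  exists (projT1 t), (sval (projT2 t)) => r.
  by split=> [/ht //|]; apply: Span_J.
have step (t : T) : exists t' : T, (forall r, Span t r -> Span t' r) /\ exists r, Span t' r /\ ~ Span t r.
  have [r hr] : exists r, ~ (J r -> Span t r) by apply/existsNP => h; apply: no; exists t.
  have [Jr nr] : J r /\ ~ Span t r by apply/not_implyP.
  case: t nr {hr} => m [A hA] nr.
  have hA' (u : 'rV_(m + 1)) : J ((u *m col_mx A (const_mx r)) 0 0).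
    rewrite -[u]hsubmxK mul_row_col mxE; apply: smemD => //.
    by rewrite mxE big_ord1 [X in _ * X]mxE; apply: (smemZ (rsubmx u 0 0)).
  exists (existT _ (m + 1)%N (exist _ (col_mx A (const_mx r)) hA')); split.
    by move=> s [u /= ->]; exists (row_mx u 0); rewrite /= mul_row_col mul0mx addr0.
  exists r; split=> //; exists (row_mx 0 1%:M).
  by rewrite /= mul_row_col mul0mx add0r mul1mx mxE.
have [next nextP] := choice step.
have hA0 (u : 'rV[R]_0) : J ((u *m (0 : 'cV_0)) 0 0) by rewrite mulmx0 mxE; apply: smem0.
pose st k := iter k next (existT _ 0%N (exist _ (0 : 'cV_0) hA0)).
pose S k : {pred (R^o : lmodType R)} := fun r => `[< Span (st k) r >].
have [k|k r /asboolP h|N hN] := noethR (S := S).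
- split; first by apply/asboolP; exists 0; rewrite mul0mx mxE.
  move=> a r s /asboolP[u ->] /asboolP[v ->]; apply/asboolP; exists (a *: u + v).
  by rewrite mulmxDl -scalemxAl !mxE.
- by apply/asboolP; have [h' _] := nextP (st k); apply: h'.
have [_ [r [hr nr]]] := nextP (st N); case: nr.
have e : `[< Span (st N.+1) r >] = `[< Span (st N) r >] := hN N.+1 (leqnSn N) r.
by apply/asboolP; rewrite -e; apply/asboolP.
Qed.

(** Generators of the ideal of first coordinates, completed to rows of [P],
    together with generators of the part of [P] with first coordinate zero. *)
Lemma noetherian_rows_step n :
  (forall P : submodule ('rV[R]_n : lmodType R),
     exists m (A : 'M[R]_(m, n)), forall v, P v <-> exists u, v = u *m A) ->
  forall P : submodule ('rV[R]_(1 + n) : lmodType R),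
     exists m (A : 'M[R]_(m, 1 + n)), forall v, P v <-> exists u, v = u *m A.
Proof.
move=> IH P.
have J0 : exists w : 'rV[R]_n, P (row_mx (0 : R)%:M w).
  by exists 0; rewrite raddf0 row_mx0; apply: smem0.
have JP (a r s : R) : (exists w : 'rV[R]_n, P (row_mx r%:M w)) ->
    (exists w : 'rV[R]_n, P (row_mx s%:M w)) ->
    exists w : 'rV[R]_n, P (row_mx (a * r + s)%:M w).
  move=> [u hu] [v hv]; exists (a *: u + v); have := smemP a hu hv.
  by rewrite scale_row_mx add_row_mx raddfD /= scale_scalar_mx.
have [m1 [A1 A1P]] := noetherian_ideal (@Submodule R (R^o : lmodType R) _ J0 JP).
have gen i : exists w : 'rV[R]_n, P (row_mx (A1 i 0)%:M w).
  apply/A1P; exists (delta_mx 0 i); by rewrite -rowE mxE.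
have [W WP] := choice gen.
have K0 : P (row_mx 0 0) by rewrite row_mx0; apply: smem0.
have KP (a : R) (u v : 'rV[R]_n) : P (row_mx 0 u) -> P (row_mx 0 v) ->
    P (row_mx 0 (a *: u + v)).
  by move=> hu hv; have := smemP a hu hv; rewrite scale_row_mx add_row_mx scaler0 addr0.
have [m2 [A2 A2P]] := IH (@Submodule R ('rV[R]_n : lmodType R) (fun w => P (row_mx 0 w)) K0 KP).
pose B : 'M[R]_(m1, 1 + n) := row_mx A1 (\matrix_i W i).
have BP (u : 'rV_m1) : P (u *m B).
  apply: submodule_rows => i; rewrite row_row_mx rowK.
  by have -> : row i A1 = (A1 i 0)%:M by rewrite [RHS]mx11_scalar; apply/rowP => j; rewrite !mxE !ord1 eqxx.
have row0P (w : 'rV_m2) : P (w *m (row_mx 0 A2 : 'M_(m2, 1 + n))).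
  by rewrite mul_mx_row mulmx0; apply/A2P; exists w.
exists (m1 + m2)%N, (col_mx B (row_mx 0 A2)) => v; split=> [Pv|[u ->]]; last first.
  by rewrite -[u]hsubmxK mul_row_col; apply: smemD.
have /A1P[u1 e1] : exists w : 'rV[R]_n, P (row_mx (lsubmx v 0 0)%:M w).
  by exists (rsubmx v); rewrite -mx11_scalar hsubmxK.
have {}e1 : lsubmx v = u1 *m A1 by rewrite [LHS]mx11_scalar e1 -mx11_scalar.
have : P (row_mx 0 (rsubmx v - u1 *m \matrix_i W i)).
  have := smemB Pv (BP u1); rewrite -[v in v - _]hsubmxK mul_mx_row.
  by rewrite opp_row_mx add_row_mx e1 subrr.
move=> /A2P[u2 e2]; exists (row_mx u1 u2).
by rewrite mul_row_col !mul_mx_row mulmx0 add_row_mx addr0 -e2 addrC subrK -e1 hsubmxK.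
Qed.

Lemma noetherian_rows n (P : submodule ('rV[R]_n : lmodType R)) :
  exists m (A : 'M[R]_(m, n)), forall v, P v <-> exists u, v = u *m A.
Proof.
elim: n P => [|n IH] P; last exact: noetherian_rows_step.
exists 0%N, 0 => v; split=> _; first by exists 0; apply/rowP => -[].
by rewrite (_ : v = 0); [exact: smem0 | apply/rowP => -[]].
Qed.

End RowModules.

(** The resolution by left modules of rows with differentials [u |-> u *m D k],
    and below that by right modules of columns with [v |-> D k *m v]. *)
Definition row_exact (R : pzRingType) (a : nat -> nat) (D : forall k, 'M[R]_(a k.+1, a k)) :=
  forall k (u : 'rV_(a k.+1)), u *m D k = 0 <-> exists w, u = w *m D k.+1.

Definition col_exact (R : pzRingType) (a : nat -> nat) (D : forall k, 'M[R]_(a k, a k.+1)) :=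
  forall k (v : 'cV_(a k.+1)), D k *m v = 0 <-> exists w, v = D k.+1 *m w.

(** Every matrix begins a resolution.  As an induction principle this avoids
    casts between the dimensions of the matrix and those of the resolution. *)
Lemma row_resolution_ind (R : pzRingType) (P : forall p q, 'M[R]_(p, q) -> Prop) :
  noetherian_module (R^o : lmodType R) ->
  (forall a (D : forall k, 'M[R]_(a k.+1, a k)), row_exact D -> P _ _ (D 0%N)) ->
  forall p q (M : 'M[R]_(p, q)), P p q M.
Proof.
move=> noethR IH p0 q0 M0.
have ker p q (M : 'M[R]_(p, q)) : exists t : {m : nat & 'M[R]_(m, p)},
    forall u : 'rV_p, u *m M = 0 <-> exists w, u = w *m projT2 t.
  by have [m [A AP]] := noetherian_rows noethR (kernel (mul_by M)); exists (existT _ m A).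
pose next p q M := projT1 (cid (ker p q M)).
have nextP p q M : forall u : 'rV_p, u *m M = 0 <-> exists w, u = w *m projT2 (next p q M).
  by rewrite /next; case: cid.
pose st := fix st k : {p : nat & {q : nat & 'M[R]_(p, q)}} :=
  if k is k'.+1 then
    let t := st k' in
    let t' := next _ _ (projT2 (projT2 t)) in
    existT _ (projT1 t') (existT _ (projT1 t) (projT2 t'))
  else existT _ p0 (existT _ q0 M0).
pose a k := if k is k'.+1 then projT1 (st k') else q0.
pose D k : 'M[R]_(a k.+1, a k) :=
  match k with 0 => M0 | k'.+1 => projT2 (projT2 (st k'.+1)) end.
by apply: (IH a D) => -[|k] u; apply: nextP.
Qed.

Lemma mulmx_converse (R : pzRingType) m n p (A : 'M[R]_(m, n)) (B : 'M[R]_(n, p)) :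
  A *m B = ((B^T : 'M[R^c]_(p, n)) *m (A^T : 'M[R^c]_(n, m)))^T.
Proof. by rewrite -trmx_mul_rev trmxK. Qed.

Lemma col_exact_converse (R : pzRingType) a (D : forall k, 'M[R]_(a k, a k.+1)) :
  col_exact D <-> row_exact (fun k => (D k)^T : 'M[R^c]_(a k.+1, a k)).
Proof.
have eq0 m n (A : 'M[R]_(m, n)) : A^T = 0 <-> A = 0.
  by split=> [/(congr1 trmx)|->]; rewrite ?trmxK trmx0.
split=> h k v.
- rewrite -eq0 -[v in v *m _]trmxK -mulmx_converse h.
  split=> [[w ew]|[w ew]]; exists w^T.
    by rewrite -[v]trmxK ew mulmx_converse trmxK.
  by rewrite ew [RHS]mulmx_converse trmxK.
- rewrite mulmx_converse eq0 h.
  split=> [[w ew]|[w ew]]; exists w^T.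
    by rewrite [RHS]mulmx_converse trmxK -ew trmxK.
  by rewrite ew [in LHS]mulmx_converse trmxK.
Qed.

Lemma col_resolution_ind (R : pzRingType) (P : forall p q, 'M[R]_(p, q) -> Prop) :
  noetherian_module ((R^c)^o : lmodType R^c) ->
  (forall a (D : forall k, 'M[R]_(a k, a k.+1)), col_exact D -> P _ _ (D 0%N)) ->
  forall p q (M : 'M[R]_(p, q)), P p q M.
Proof.
move=> noethR IH p q M; rewrite -[M]trmxK.
apply: (@row_resolution_ind R^c (fun p q (N : 'M[R^c]_(p, q)) => P q p (N^T : 'M[R]_(q, p))) noethR).
move=> a D Dx; apply: (IH a (fun k => (D k)^T)); apply/col_exact_converse => k u.
by rewrite !trmxK; apply: Dx.
Qed.

Section Cokernels.
Variables (R : pzRingType) (a : nat -> nat) (D : forall k, 'M[R]_(a k.+1, a k)).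
Hypothesis Dx : row_exact D.
Implicit Types C Y : lmodType R.

Definition is_cokernel k C (p : {linear 'rV[R]_(a k) -> C}) :=
  surjective_map p /\ forall u, p u = 0 <-> exists w, u = w *m D k.

Lemma is_cokernel_exists k : exists C (p : {linear 'rV[R]_(a k) -> C}), is_cokernel p.
Proof.
have [C [p [p_surj pE]]] := quotient_exists (lin_image (mul_by (D k))).
by exists C, p; split=> // u; rewrite pE; split=> -[w e]; exists w.
Qed.

Lemma cokernel_step k C (p : {linear 'rV[R]_(a k) -> C}) C' (p' : {linear 'rV[R]_(a k.+1) -> C'}) :
  is_cokernel p -> is_cokernel p' ->
  exists i : {linear C' -> 'rV[R]_(a k)}, short_exact i p /\ forall u, i (p' u) = u *m D k.
Proof.
move=> [p_surj pE] [p'_surj p'E].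
have [|i iE] := @factor_surj R _ _ _ p' (mul_by (D k)) p'_surj.
  by move=> u /p'E/Dx.
exists i; split=> //; split=> //.
- apply: linear_inj => x; have [u <-] := p'_surj x.
  by rewrite iE /= => /Dx/p'E.
- move=> y; rewrite pE; split=> [[w ->]|[x <-]]; first by exists (p' w); rewrite iE.
  by have [u <-] := p'_surj x; exists u; rewrite iE.
Qed.

Lemma cokernel_shift C0 (p0 : {linear 'rV[R]_(a 0) -> C0}) k :
  is_cokernel p0 -> exists C (p : {linear 'rV[R]_(a k) -> C}), is_cokernel p /\
    forall m Y, Ext_vanish m C Y <-> Ext_vanish (m + k) C0 Y.
Proof.
move=> h0; elim: k => [|k [C [p [hp IH]]]].
  by exists C0, p0; split=> // m Y; rewrite addn0.
have [C' [p' hp']] := is_cokernel_exists k.+1; exists C', p'; split=> // m Y.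
have [i [se _]] := cokernel_step hp hp'.
by rewrite addnS -addSn -IH; exact: (Ext_vanish_presentation m Y se (@row_projective R _)).
Qed.

End Cokernels.

(** * Gorenstein rings: injective dimension, projective dimension and flatness *)

Section InjDim.
Variable R : pzRingType.
Implicit Types A C F I K M P Y : lmodType R.

Definition inj_dim_le n Y := forall A, Ext_vanish n A Y.

(** Shift along the given injective resolution of [Y]. *)
Lemma injective_dim_le_Ext n Y : injective_dim_le Y n -> inj_dim_le n Y.
Proof.
elim: n Y => [|n IH] Y [I [e [d [injI zeroI e_inj ex0 exS]]]] A.
  have d0 x : d 0%N x = 0 := zeroI 1%N isT _.
  have pick x : exists y, e y = x by apply/ex0.
  have [|g gE] := @factor_inj R _ _ _ e (id_lin (I 0%N)) e_inj; first exact: pick.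
  apply/Ext1P => E i p [i_inj _ _].
  have [h hE] := injI 0%N isT _ _ i e i_inj.
  by exists (lin_comp g h) => b; apply: e_inj; rewrite /= hE gE.
have [C [p se]] := cokernel_exists e_inj.
have [_ ep p_surj] := se.
have [|e' e'E] := @factor_surj R _ _ _ p (d 0%N) p_surj; first by move=> x /ep/ex0.
apply/(Ext_vanish_copresentation n A se (injI 0%N isT)); apply: IH.
exists (fun k => I k.+1), e', (fun k => d k.+1); split=> //.
- by move=> k kn; apply: injI.
- by move=> k kn; apply: zeroI.
- apply: linear_inj => y; have [x <-] := p_surj y; rewrite e'E => /ex0 h.
  exact/ep.
- move=> y; rewrite (exS 0%N y); split=> [[x <-]|[x <-]]; first by exists (p x).
  by have [z <-] := p_surj x; exists z; rewrite e'E.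
Qed.

Lemma inj_dim_leS n Y : inj_dim_le n Y -> inj_dim_le n.+1 Y.
Proof. by move=> h A; rewrite Ext_vanishS. Qed.

Lemma inj_dim_iter n Y : inj_dim_le n Y <-> injective_module (iter n (@cosyz R) Y).
Proof.
split=> [h|h A]; last exact/Ext_vanish_iter/injective_Ext1.
by apply: Ext1_injective => A; apply/Ext_vanish_iter.
Qed.

(** Baer's criterion for the cosyzygy of order [n]. *)
Lemma inj_dim_le_Baer n Y :
  (forall (J : submodule (R^o : lmodType R)) C (p : {linear R^o -> C}),
     surjective_map p -> (forall r, p r = 0 <-> J r) -> Ext_vanish n C Y) ->
  inj_dim_le n Y.
Proof.
move=> h; apply/inj_dim_iter/Baer => J f.
have [C [p [p_surj pJ]]] := quotient_exists J.
have se : short_exact (sub_incl J) p.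
  split=> //; first exact: sub_incl_inj.
  by move=> y; rewrite pJ; exact: sub_inclP.
have /Ext_vanish_iter ext := h J C p p_surj pJ.
have [g gE] := Ext1_extend f se ext.
exists (g 1) => r; rewrite -gE -linearZ; congr (g _).
by rewrite /= [RHS]mulr1.
Qed.

(** The map [f] is a cocycle of degree [n + 1] with values in [Y] for the
    resolution [D], so it is a coboundary. *)
Lemma row_exact_lift n a (D : forall k, 'M[R]_(a k.+1, a k)) Y (f : {linear 'rV[R]_(a n.+1) -> Y}) :
  inj_dim_le n Y -> row_exact D -> (forall u, f (u *m D n.+1) = 0) ->
  exists g : {linear 'rV[R]_(a n) -> Y}, forall u, f u = g (u *m D n).
Proof.
move=> hY Dx fD; have [C0 [p0 h0]] := is_cokernel_exists D 0.
have [C [p [hp CE]]] := cokernel_shift Dx n h0.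
have [C' [p' hp']] := is_cokernel_exists D n.+1.
have [i [se iE]] := cokernel_step Dx hp hp'; have [p'_surj p'E] := hp'.
have [|f' f'E] := @factor_surj R _ _ _ p' f p'_surj; first by move=> u /p'E[w ->].
have extC : Ext1_eq0 C Y by apply/(CE 0%N); rewrite add0n.
have [g gE] := Ext1_extend f' se extC.
by exists g => u; rewrite -f'E -gE iE.
Qed.

End InjDim.

Lemma col_exact_mul0 (R : pzRingType) a (D : forall k, 'M[R]_(a k, a k.+1)) k :
  col_exact D -> D k *m D k.+1 = 0.
Proof.
move=> Dx; apply/matrixP => i j.
have : D k *m (D k.+1 *m (delta_mx j 0 : 'cV_ _)) = 0.
  by apply/Dx; exists (delta_mx j 0).
by rewrite mulmxA -colE => /colP/(_ i); rewrite !mxE.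
Qed.

Lemma matrix_lift n (R : pzRingType) a (D : forall k, 'M[R]_(a k.+1, a k)) m (A : 'M[R]_(a n.+1, m)) :
  inj_dim_le n (R^o : lmodType R) -> row_exact D -> D n.+1 *m A = 0 ->
  exists A', A = D n *m A'.
Proof.
move=> hR Dx DA.
have fL j : linear (fun u : 'rV[R]_(a n.+1) => (u *m A) 0 j : R^o).
  by move=> b u v; rewrite mulmxDl -scalemxAl !mxE.
have lift j : exists g : {linear 'rV[R]_(a n) -> R^o}, forall u, (u *m A) 0 j = g (u *m D n).
  have [|g gE] := row_exact_lift (f := Lin (fL j)) hR Dx; last by exists g => u; rewrite -gE.
  by move=> u; rewrite /= -mulmxA DA mulmx0 mxE.
have [g gE] := choice lift.
exists (\matrix_(i, j) g j (delta_mx 0 i)); apply/matrixP => i j.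
have := gE j (delta_mx 0 i); rewrite -!rowE mxE => ->.
rewrite [row i (D n)]row_sum_delta linear_sum mxE; apply: eq_bigr => k _.
by rewrite linearZ !mxE.
Qed.

Lemma row_dual_exact n (R : pzRingType) a (D : forall k, 'M[R]_(a k, a k.+1)) (u : 'rV[R]_(a n.+1)) :
  inj_dim_le n ((R^c)^o : lmodType R^c) -> col_exact D -> u *m D n.+1 = 0 ->
  exists w, u = w *m D n.
Proof.
move=> hR /col_exact_converse Dx uD.
have [|w ew] := matrix_lift (A := (u^T : 'M[R^c]_(_, _))) hR Dx.
  by rewrite -trmx_mul_rev uD trmx0.
by exists w^T; rewrite mulmx_converse trmxK -ew trmxK.
Qed.

Section Flatness.
Variable R : pzRingType.
Implicit Types A C F I K M P Y : lmodType R.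

(** For right modules with a resolution [D] by finitely generated free modules,
    this is the vanishing of [Tor] in degree [k + 1] against [M]; a linear map
    from ['rV_a] to [M] stands for a column of [a] elements of [M]. *)
Definition Tor_vanish k M :=
  forall a (D : forall k, 'M[R]_(a k, a k.+1)) (z : {linear 'rV[R]_(a k.+1) -> M}),
    col_exact D -> (forall u, z (u *m D k) = 0) ->
    exists w : {linear 'rV[R]_(a k.+2) -> M}, forall u, z u = w (u *m D k.+1).

Lemma Tor_vanishS k M : Tor_vanish k M -> Tor_vanish k.+1 M.
Proof.
move=> h a D z Dx; apply: (h (fun j => a j.+1) (fun j => D j.+1)) => j.
exact: Dx.
Qed.

(** Dualizing the resolution into the ring and then into [I] is tensoring it
    with [I]; the first duality is exact in degree [n + 1] by the bound on the
    injective dimension of the ring on the right, the second because [I] is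
    injective. *)
Lemma Tor_vanish_injective n I :
  inj_dim_le n ((R^c)^o : lmodType R^c) -> injective_module I -> Tor_vanish n I.
Proof.
move=> hR injI a D z Dx zD.
set f := mul_by (D n.+1); pose i := sub_incl (lin_image f).
have [|f' f'E] := @factor_inj R _ _ _ i f (@sub_incl_inj _ _ _).
  by move=> u; apply/(sub_inclP (lin_image f)); exists u.
have f'_surj : surjective_map f'.
  move=> y; have /sub_inclP[u eu] : exists y', i y' = i y by exists y.
  by exists u; apply: (@sub_incl_inj _ _ (lin_image f)); rewrite f'E.
have [|z' z'E] := @factor_surj R _ _ _ f' z f'_surj.
  move=> u e; have [|w ->] := @row_dual_exact n R a D u hR Dx; last exact: zD.
  by have := f'E u; rewrite e linear0.
have [w wE] := injI _ _ i z' (@sub_incl_inj _ _ _).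
by exists w => u; rewrite -z'E -wE f'E.
Qed.

(** Lift a chain from [K] to [P] to [M], correct it there, and come back. *)
Lemma Tor_vanish_kernel k K P M (i : {linear K -> P}) (p : {linear P -> M}) :
  short_exact i p -> Tor_vanish k P -> Tor_vanish k.+1 M -> Tor_vanish k K.
Proof.
move=> se hP hM a D z Dx zD; have [i_inj ip p_surj] := se.
have [|w wE] := hP a D (lin_comp i z) Dx; first by move=> u; rewrite /= zD linear0.
have [|y yE] := hM a D (lin_comp p w) Dx.
  by move=> u; rewrite /= -wE /= (short_exact_comp0 _ se).
have [y' y'E] := row_projective y p_surj.
have [|w' w'E] := @factor_inj R _ _ _ i (sub_lin w (lin_comp y' (mul_by (D k.+2)))) i_inj.
  by move=> u; apply/ip; rewrite /= linearB y'E -yE /= subrr.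
exists w' => u; apply: i_inj; rewrite w'E /= -mulmxA col_exact_mul0 //.
by rewrite mulmx0 linear0 subr0 -wE.
Qed.

(** Solve the equations for each basis element separately, choosing the zero
    solution where the data vanish, to keep the support finite. *)
Lemma Tor_vanish_free k (B : Type) : Tor_vanish k (free_module R B).
Proof.
move=> a D z Dx zD; pose x i := z (delta_mx 0 i).
pose v b : 'cV[R]_(a k.+1) := \col_i coeff (x i) b.
have Dv b : D k *m v b = 0.
  apply/colP => i; rewrite !mxE -[RHS](coeff0 R b) -(zD (delta_mx 0 i)) -rowE.
  rewrite [row i (D k)]row_sum_delta linear_sum coeff_sum; apply: eq_bigr => j _.
  by rewrite linearZ coeffZ !mxE.
have lift b : exists w : 'cV[R]_(a k.+2), v b = D k.+1 *m w /\ (v b = 0 -> w = 0).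
  have [e|ne] := EM (v b = 0); first by exists 0; rewrite mulmx0.
  by have /Dx[w ew] := Dv b; exists w; split=> // /ne.
have [w wE] := choice lift.
pose s : seq {classic B} := flatten [seq supp (x i) | i <- enum 'I_(a k.+1)].
have w0 j (b : {classic B}) : w b j 0 <> 0 -> b \in s.
  move=> wb; have [i] : exists i, v b i 0 <> 0.
    apply/existsNP => v0; have [_ w0] := wE b; case: wb.
    by rewrite w0 ?mxE //; apply/colP => i; rewrite v0 mxE.
  rewrite mxE => /mem_supp bi; apply/flattenP; exists (supp (x i)) => //.
  by apply/mapP; exists i; rewrite ?mem_enum.
have [y yE] := choice (fun j => from_coefs (w0 j)).
exists (row_map y); apply: (row_linear_eq (g := lin_comp (row_map y) (mul_by (D k.+1)))) => i.
apply: coeff_inj => b; rewrite /= -rowE coeff_sum.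
have := congr1 (fun M : 'cV_ _ => M i 0) (wE b).1; rewrite !mxE => ->.
by apply: eq_bigr => j _; rewrite coeffZ yE !mxE.
Qed.

(** The equational criterion for flatness. *)
Definition flat_module F :=
  forall p q (D : 'M[R]_(p, q)) (z : {linear 'rV[R]_q -> F}),
    (forall u, z (u *m D) = 0) ->
    exists m (A : 'M[R]_(q, m)) (w : {linear 'rV[R]_m -> F}),
      D *m A = 0 /\ forall u, z u = w (u *m A).

Hypothesis noeth_right : noetherian_module ((R^c)^o : lmodType R^c).

Lemma Tor_vanish_flat F : Tor_vanish 0 F -> flat_module F.
Proof.
move=> h; apply: (col_resolution_ind noeth_right) => a D Dx z zD.
have [w wE] := h a D z Dx zD; exists (a 2%N), (D 1%N), w; split=> //.
exact: col_exact_mul0.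
Qed.

Hypothesis noeth_left : noetherian_module (R^o : lmodType R).

(** By the equational criterion, a cocycle with values in a flat module comes
    from cocycles with values in the ring, and those are coboundaries. *)
Lemma flat_cokernel_vanish n F m d (M : 'M[R]_(m, d)) C (q : {linear 'rV[R]_d -> C}) :
  inj_dim_le n (R^o : lmodType R) -> flat_module F ->
  surjective_map q -> (forall u, q u = 0 <-> exists w, u = w *m M) -> Ext_vanish n C F.
Proof.
move=> hR flatF; move: m d M q.
apply: (row_resolution_ind (P := fun m d (M : 'M[R]_(m, d)) => forall q : {linear 'rV[R]_d -> C},
  surjective_map q -> (forall u, q u = 0 <-> exists w, u = w *m M) -> Ext_vanish n C F) noeth_left).
move=> a D Dx q q_surj qD.
have [C' [p [hp CE]]] := cokernel_shift Dx n (conj q_surj qD : is_cokernel D (k := 0) q).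
apply/(CE 0%N); have [C'' [p' hp']] := is_cokernel_exists D n.+1.
have [i [se iE]] := cokernel_step Dx hp hp'; have [p'_surj p'E] := hp'.
apply: (Ext1_of_extend se); first exact/projective_Ext1/row_projective.
move=> f; have [|l [A [w [DA wE]]]] := flatF _ _ (D n.+1) (lin_comp f p').
  by move=> u; rewrite /= (p'E _).2 ?linear0 //; exists u.
have [A' eA] := matrix_lift hR Dx DA.
exists (lin_comp w (mul_by A')) => x; have [u <-] := p'_surj x.
by rewrite iE /= -mulmxA -eA -wE.
Qed.

Lemma flat_inj_dim n F : inj_dim_le n (R^o : lmodType R) -> flat_module F -> inj_dim_le n F.
Proof.
move=> hR flatF; apply: inj_dim_le_Baer => J C p p_surj pJ.
have JP0 : J ((0 : 'rV[R]_1) 0 0) by rewrite mxE; apply: smem0.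
have JPP (b : R) (u v : 'rV[R]_1) : J (u 0 0) -> J (v 0 0) -> J ((b *: u + v) 0 0).
  by move=> hu hv; rewrite !mxE; apply: (smemP b hu hv).
have [m [M MP]] := noetherian_rows noeth_left
  (@Submodule R ('rV[R]_1 : lmodType R) (fun u => J (u 0 0)) JP0 JPP).
have pL : linear (fun u : 'rV[R]_1 => p (u 0 0)).
  by move=> b u v; rewrite !mxE -linearP.
pose q : {linear 'rV[R]_1 -> C} := Lin pL.
have q_surj : surjective_map q.
  by move=> c; have [r <-] := p_surj c; exists r%:M; rewrite /= mxE eqxx.
have qM u : q u = 0 <-> exists w, u = w *m M by rewrite -MP /= pJ.
exact: (flat_cokernel_vanish hR flatF q_surj qM).
Qed.

End Flatness.

Section ProjectiveDimension.
Variable R : pzRingType.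
Implicit Types A B C E F I K M N P Q X Y Z : lmodType R.

Lemma projective_retract P Q (s : {linear P -> Q}) (r : {linear Q -> P}) :
  (forall x, r (s x) = x) -> projective_module Q -> projective_module P.
Proof.
move=> rs pQ A B g f g_surj; have [h hE] := pQ _ _ g (lin_comp f r) g_surj.
by exists (lin_comp h s) => x; rewrite /= hE /= rs.
Qed.

(** The presentation splits, so [A] is a summand of [F]. *)
Lemma projective_of_split K F A (i : {linear K -> F}) (p : {linear F -> A}) :
  short_exact i p -> projective_module F -> Ext1_eq0 A K -> projective_module A.
Proof.
move=> se pF /Ext1P h; have [r rK] := h _ _ _ se.
by have [s sK] := section_of_retraction se rK; apply: projective_retract sK pF.
Qed.

Lemma Ext1_retract A B B' (i : {linear B -> B'}) (r : {linear B' -> B}) :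
  (forall x, r (i x) = x) -> Ext1_eq0 A B' -> Ext1_eq0 A B.
Proof.
move=> ri h; apply/Ext1P => E j p se; have [g gE] := Ext1_extend i se h.
by exists (lin_comp r g) => b; rewrite /= gE ri.
Qed.

Lemma projective_summand P : projective_module P ->
  exists s : {linear P -> free_module R P}, forall x, free_cover P (s x) = x.
Proof. by move=> pP; apply: (pP _ _ (free_cover P) (id_lin P)); apply: free_cover_surj. Qed.

Lemma zero_linear A B : linear (fun _ : A => 0 : B).
Proof. by move=> a u v; rewrite scaler0 addr0. Qed.

Definition zero_lin A B : {linear A -> B} := Lin (@zero_linear A B).

Lemma row0_zero : zero_module ('rV[R]_0 : lmodType R).
Proof. by move=> x; apply/rowP => -[]. Qed.

Lemma Ext_vanish_iso k A B Y (f : {linear A -> B}) :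
  injective f -> surjective_map f -> Ext_vanish k A Y -> Ext_vanish k B Y.
Proof.
move=> f_inj f_surj h; have se : short_exact f (zero_lin B 'rV[R]_0).
  split; first exact: f_inj.
    by move=> y; split.
  by move=> y; exists 0; rewrite [y]row0_zero.
apply: (Ext_vanish_middle se h); apply: Ext_vanish_projective.
exact/zero_projective/row0_zero.
Qed.

Lemma Ext_vanish_add m k A Y : Ext_vanish (m + k) A Y = Ext_vanish m (iter k (@syzygy R) A) Y.
Proof. by rewrite /Ext_vanish iterD. Qed.

Definition proj_dim_le m M := forall Z, Ext_vanish m M Z.

Lemma proj_dim_leS m M : proj_dim_le m M -> proj_dim_le m.+1 M.
Proof. by move=> h Z; apply/Ext_vanish_cosyz. Qed.

Lemma proj_dim_leW m k M : proj_dim_le m M -> proj_dim_le (m + k) M.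
Proof. by move=> h; elim: k => [|k IH]; rewrite ?addn0 // addnS; apply: proj_dim_leS. Qed.

Lemma Tor_vanish_syzygy k j M : Tor_vanish (k + j) M -> Tor_vanish k (iter j (@syzygy R) M).
Proof.
elim: j k => [|j IH] k; first by rewrite addn0.
rewrite addnS -addSn => /IH h.
exact: Tor_vanish_kernel (syzygy_exact _) (@Tor_vanish_free _ _ _) h.
Qed.

End ProjectiveDimension.

Section Gorenstein.
Variables (R : pzRingType) (n : nat).
Hypothesis gorR : n_gorenstein n R.
Implicit Types A B C E F G I K M N P Q X Y Z : lmodType R.

Let noeth_left : noetherian_module (R^o : lmodType R).
Proof. by case: gorR. Qed.
Let noeth_right : noetherian_module ((R^c)^o : lmodType R^c).
Proof. by case: gorR. Qed.
Let inj_left : inj_dim_le n (R^o : lmodType R).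
Proof. by case: gorR => _ _ [/injective_dim_le_Ext]. Qed.
Let inj_right : inj_dim_le n ((R^c)^o : lmodType R^c).
Proof. by case: gorR => _ _ _ [/injective_dim_le_Ext]. Qed.

Lemma Tor_inj_dim F : Tor_vanish 0 F -> inj_dim_le n F.
Proof.
by move=> h; apply: (flat_inj_dim noeth_left inj_left); apply: (Tor_vanish_flat noeth_right).
Qed.

Lemma projective_inj_dim P : projective_module P -> inj_dim_le n P.
Proof.
move=> /projective_summand[s sK] A; apply: (Ext1_retract sK).
exact/Tor_inj_dim/Tor_vanish_free.
Qed.

(** Let [K] be the [n]-th syzygy of an injective module.  Both [K] and its
    syzygy are flat, so the latter has injective dimension at most [n]; hence
    the class of the presentation of [K] vanishes, and [K] is projective. *)
Lemma injective_proj_dim I : injective_module I -> proj_dim_le n I.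
Proof.
move=> injI; set K := iter n (@syzygy R) I.
have torK : Tor_vanish 0 K.
  by apply: Tor_vanish_syzygy; rewrite add0n; apply: Tor_vanish_injective inj_right injI.
have injK : inj_dim_le n (syzygy K).
  apply: Tor_inj_dim; apply: Tor_vanish_kernel (syzygy_exact K) (@Tor_vanish_free _ _ _) _.
  exact: Tor_vanishS.
have pK : projective_module K.
  exact: projective_of_split (syzygy_exact K) (@free_projective _ _) (injK I).
by move=> Z; apply: projective_Ext1.
Qed.

(** Induction along the injective coresolution of [Y], whose terms have
    projective dimension at most [n]. *)
Lemma inj_dim_proj_dim j Y : inj_dim_le j Y -> proj_dim_le n Y.
Proof.
elim: j Y => [|j IH] Y hY; first exact/injective_proj_dim/Ext1_injective.
move=> Z; apply: Ext_vanish_left (cop_exact (copresentation Y)) _ _.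
  exact/injective_proj_dim/cop_injective.
by apply: proj_dim_leS; apply: IH => A; apply/Ext_vanish_cosyz.
Qed.

(** * Gorenstein projective dimension by vanishing of extension groups *)

(** By [gorenstein_projective_dimP] this is a bound on the Gorenstein projective
    dimension; in this form it is a left orthogonal class, which is hereditary
    since the modules of injective dimension at most [n] are closed under
    cosyzygies. *)
Definition gproj_dim_le k X := forall Y, inj_dim_le n Y -> Ext_vanish k X Y.

Lemma inj_dim_cosyz Y : inj_dim_le n Y -> inj_dim_le n (cosyz Y).
Proof. by move=> h A; apply/Ext_vanish_cosyz; apply: inj_dim_leS. Qed.

Lemma gproj_dim_leS k X : gproj_dim_le k X -> gproj_dim_le k.+1 X.
Proof. by move=> h Y hY; apply/Ext_vanish_cosyz/h/inj_dim_cosyz. Qed.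

Lemma gproj_dim_le0 k X : gproj_dim_le 0 X -> gproj_dim_le k X.
Proof. by move=> h; elim: k => // k; apply: gproj_dim_leS. Qed.

Lemma gproj_dim_syzygy k X : gproj_dim_le k X -> gproj_dim_le 0 (iter k (@syzygy R) X).
Proof. by move=> h Y hY; have := h Y hY; rewrite -[k in Ext_vanish k]add0n Ext_vanish_add. Qed.

Lemma projective_gproj_dim k P : projective_module P -> gproj_dim_le k P.
Proof. by move=> pP Y _; apply: Ext_vanish_projective. Qed.

Lemma gproj_dim_middle k A' A A'' (i : {linear A' -> A}) (p : {linear A -> A''}) :
  short_exact i p -> gproj_dim_le k A' -> gproj_dim_le k A'' -> gproj_dim_le k A.
Proof. by move=> se h' h'' Y hY; apply: Ext_vanish_middle se (h' Y hY) (h'' Y hY). Qed.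

(** Going down the resolution, each syzygy in turn is projective, hence has
    injective dimension at most [n], and the presentation above it splits. *)
Lemma gproj_proj_dim_projective m X : gproj_dim_le 0 X -> proj_dim_le m X -> projective_module X.
Proof.
elim: m X => [|m IH] X gX pX; first exact: Ext1_projective.
have pK : projective_module (syzygy X).
  apply: IH; last by move=> Z; have := pX Z; rewrite Ext_vanishS.
  by apply: (gproj_dim_syzygy (k := 1)); apply: gproj_dim_leS.
apply: projective_of_split (syzygy_exact X) (@free_projective _ _) (gX _ _).
exact: projective_inj_dim.
Qed.

(** By Baer's criterion it is enough to test the [n]-th syzygies of the cyclic
    modules, and these are small. *)
Lemma small_orth_inj_dim k Y : small_orth (gproj_dim_le k) Y -> inj_dim_le n Y.
Proof.
move=> h; apply: inj_dim_le_Baer => J C p p_surj _; apply: h; split.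
  by apply: gproj_dim_le0 => Z hZ; apply: hZ.
exact/small_iter_syzygy/(small_quotient p_surj)/small_ring.
Qed.

Lemma inj_dim_preenvelope X :
  exists N G (j : {linear X -> N}) (q : {linear N -> G}),
    [/\ short_exact j q, inj_dim_le n N & gproj_dim_le 0 G].
Proof.
have [N [G [j [q [se oN oG]]]]] := small_orth_preenvelope (gproj_dim_le 0) X.
exists N, G, j, q; split=> //; first exact: small_orth_inj_dim oN.
by move=> Y hY; apply: oG => A [gA _]; apply: gA.
Qed.

(** The step from which the right half of a complete resolution is iterated: the
    preenvelope [N] is orthogonal to the modules of injective dimension at most
    [n] because [X] and [G] are, and has finite projective dimension. *)
Lemma gproj_embedding X : gproj_dim_le 0 X ->
  exists P X' (i : {linear X -> P}) (p : {linear P -> X'}),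
    [/\ short_exact i p, projective_module P & gproj_dim_le 0 X'].
Proof.
move=> gX; have [N [G [j [q [se hN gG]]]]] := inj_dim_preenvelope X.
exists N, G, j, q; split=> //.
apply: (gproj_proj_dim_projective (m := n)); first exact: gproj_dim_middle se gX gG.
exact: inj_dim_proj_dim hN.
Qed.

(** [X] is a syzygy of arbitrarily high order of later cocycles. *)
Lemma cocycle_Ext_vanish k m (U : nat -> lmodType R) (d : forall i, {linear U i -> U i.+1})
    X (j : {linear X -> U 0%N}) Y :
  (forall i, projective_module (U i)) -> (forall i, exact_at (d i) (d i.+1)) ->
  injective j -> exact_at j (d 0%N) -> inj_dim_le n Y -> (k + m)%N = n -> Ext_vanish k X Y.
Proof.
elim: m k U d X j => [|m IH] k U d X j pU dx j_inj jx hY ekm.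
  by move: hY; rewrite -ekm addn0; apply.
pose i := sub_incl (kernel (d 1%N)).
have ix : exact_at i (d 1%N) by move=> y; exact: (sub_inclP (kernel (d 1%N))).
have i_inj : injective i := @sub_incl_inj _ _ _.
have [|p pE] := @factor_inj R _ _ _ i (d 0%N) i_inj.
  by move=> z; apply/ix/dx; exists z.
have se : short_exact j p.
  split=> //.
  - move=> y; rewrite -(jx y) -pE.
    by split=> [->|e]; [rewrite linear0 | apply: i_inj; rewrite e linear0].
  - move=> x; have /dx[z ez] : d 1%N (i x) = 0 by apply/ix; exists x.
    by exists z; apply: i_inj; rewrite pE.
apply: Ext_vanish_left se _ _; first exact: Ext_vanish_projective.
apply: (IH k.+1 (fun i => U i.+1) (fun i => d i.+1) _ i) => //.
by rewrite addSn -addnS.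
Qed.

Lemma gorenstein_projective_gproj X : gorenstein_projective X -> gproj_dim_le 0 X.
Proof.
move=> [L [U [dL [c [dU [pLU _ _ xU [j [j_inj jx]]]]]]]] Y hY.
apply: (cocycle_Ext_vanish (m := n) (U := U) (d := dU) _ _ j_inj jx hY) => // i.
  by case: (pLU i).
by case: (xU i).
Qed.

(** The complete resolution is spliced from short exact sequences, and the maps
    to projective modules extend along the inclusion of each cocycle module. *)
Lemma splice_totally_exact A Z B Z' C (q : {linear A -> Z}) (a : {linear Z -> B})
    (b : {linear B -> Z'}) (c : {linear Z' -> C}) :
  surjective_map q -> short_exact a b -> injective c ->
  (forall Q, projective_module Q -> forall h : {linear Z' -> Q},
     exists h' : {linear C -> Q}, forall x, h' (c x) = h x) ->
  totally_exact_at (lin_comp a q) (lin_comp c b).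
Proof.
move=> q_surj se c_inj ext; have [a_inj ab b_surj] := se.
have cb0 y : c (b y) = 0 <-> b y = 0.
  by split=> [e|->]; [apply: c_inj; rewrite e linear0 | rewrite linear0].
split=> [y|Q pQ h].
  rewrite /= cb0 ab; split=> [[z <-]|[x <-]]; last by exists (q x).
  by have [x <-] := q_surj z; exists x.
split=> [haq|[k kE] x]; last by rewrite -kE /= (short_exact_comp0 _ se) !linear0.
have [|h' h'E] := @factor_surj R _ _ _ b h b_surj.
  by move=> y /ab[z <-]; have [x <-] := q_surj z; apply: haq.
have [k kE] := ext Q pQ h'.
by exists k => y; rewrite /= kE h'E.
Qed.

Record gproj_step (X : {X | gproj_dim_le 0 X}) := GprojStep {
  step_mid : lmodType R;
  step_next : {X | gproj_dim_le 0 X};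
  step_in : {linear sval X -> step_mid};
  step_out : {linear step_mid -> sval step_next};
  step_exact : short_exact step_in step_out;
  step_projective : projective_module step_mid }.

Fact gproj_step_exists (T : {X | gproj_dim_le 0 X}) : exists s : gproj_step T, True.
Proof.
have [P [X' [i [p [se pP gX']]]]] := gproj_embedding (svalP T).
by exists (@GprojStep T P (exist _ X' gX') i p se pP).
Qed.

Lemma gproj_gorenstein_projective X : gproj_dim_le 0 X -> gorenstein_projective X.
Proof.
move=> gX; pose step T := projT1 (cid (gproj_step_exists T)).
pose st k := iter k (fun T => step_next (step T)) (exist _ X gX).
pose U k := step_mid (step (st k)).
pose iU k : {linear sval (st k) -> U k} := step_in (step (st k)).
pose pU k : {linear U k -> sval (st k.+1)} := step_out (step (st k)).
have seU k : short_exact (iU k) (pU k) := step_exact (step (st k)).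
pose S k := iter k (@syzygy R) X; pose L k := free_module R (S k).
pose iL k : {linear S k.+1 -> L k} := syzygy_incl (S k).
pose pL k : {linear L k -> S k} := free_cover (S k).
have seL k : short_exact (iL k) (pL k) := syzygy_exact (S k).
have iU_inj k : injective (iU k) by case: (seU k).
have pU_surj k : surjective_map (pU k) by case: (seU k).
have iL_inj k : injective (iL k) by case: (seL k).
have pL_surj k : surjective_map (pL k) by case: (seL k).
have gS k : gproj_dim_le 0 (S k) by apply: gproj_dim_syzygy; apply: gproj_dim_le0.
have extU k Q (pQ : projective_module Q) (h : {linear sval (st k) -> Q}) :
    exists h' : {linear U k -> Q}, forall x, h' (iU k x) = h x.
  by apply: Ext1_extend (seU k) _; apply: (svalP (st k.+1)); apply: projective_inj_dim.
have extL k Q (pQ : projective_module Q) (h : {linear S k.+1 -> Q}) :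
    exists h' : {linear L k -> Q}, forall x, h' (iL k x) = h x.
  by apply: Ext1_extend (seL k) _; apply: (gS k); apply: projective_inj_dim.
exists L, U, (fun k => lin_comp (iL k) (pL k.+1)), (lin_comp (iU 0%N) (pL 0%N : {linear L 0%N -> X})),
  (fun k => lin_comp (iU k.+1) (pU k)).
split.
- by move=> k; split; [exact: free_projective | exact: step_projective].
- by move=> k; exact: splice_totally_exact (pL_surj k.+2) (seL k.+1) (iL_inj k) (extL k).
- split; first exact: splice_totally_exact (pL_surj 1%N) (seL 0%N) (iU_inj 0%N) (extU 0%N).
  exact: splice_totally_exact (pL_surj 0%N) (seU 0%N) (iU_inj 1%N) (extU 1%N).
- by move=> k; exact: splice_totally_exact (pU_surj k) (seU k.+1) (iU_inj k.+2) (extU k.+2).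
exists (iU 0%N); split; first exact: iU_inj.
move=> y; rewrite /=; have [_ ipx _] := seU 0%N; rewrite -(ipx y).
by split=> [e|->]; [apply: (iU_inj 1%N); rewrite e linear0 | rewrite linear0].
Qed.

Lemma gorenstein_projective_dimP r X : gorenstein_projective_dim_le r X <-> gproj_dim_le r X.
Proof.
split.
  elim: r X => [|r IH] X [C [e [d [gC zC e_surj ex0 exS]]]].
    move=> Y hY; apply: (Ext_vanish_iso (f := e)) => //; last first.
      by apply: gorenstein_projective_gproj hY; apply: gC.
    apply: linear_inj => x /ex0[y <-].
    by rewrite (zC 1%N isT y) linear0.
  have se := kernel_short_exact e_surj; set i := sub_incl _ in se.
  have [i_inj ie _] := se.
  have [|e' e'E] := @factor_inj R _ _ _ i (d 0%N) i_inj.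
    by move=> z; apply/ie/ex0; exists z.
  move=> Y hY; apply: Ext_vanish_right se _ _; last first.
    by apply: gproj_dim_le0 hY; apply: gorenstein_projective_gproj; apply: gC.
  apply: IH hY; exists (fun k => C k.+1), e', (fun k => d k.+1); split=> //.
  - by move=> k kr; apply: gC.
  - by move=> k kr; apply: zC.
  - move=> x; have /ex0[z ez] : e (i x) = 0 by apply/ie; exists x.
    by exists z; apply: i_inj; rewrite e'E.
  - move=> y; rewrite -(exS 0%N y) -e'E.
    by split=> [->|h]; [rewrite linear0 | apply: i_inj; rewrite h linear0].
elim: r X => [|r IH] X gX.
  pose C k := if k is 0 then X else ('rV[R]_0 : lmodType R).
  pose d k : {linear C k.+1 -> C k} := zero_lin (C k.+1) (C k).
  exists C, (id_lin X), d; split.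
  - by case=> // _; apply: gproj_gorenstein_projective.
  - by case=> // k _; apply: row0_zero.
  - by move=> x; exists x.
  - by move=> y; split=> [/= ->|[x <-] //]; exists 0.
  - by move=> k y; split=> // _; exists 0; apply/esym/row0_zero.
have [|C [e [d [gC zC e_surj ex0 exS]]]] := IH (syzygy X).
  by move=> Y hY; have := gX Y hY; rewrite Ext_vanishS.
have [i_inj ip p_surj] := syzygy_exact X.
pose C' k := if k is j.+1 then C j else free_module R X.
pose d' k : {linear C' k.+1 -> C' k} :=
  match k with 0 => lin_comp (syzygy_incl X) e | j.+1 => d j end.
exists C', (free_cover X : {linear C' 0%N -> X}), d'; split.
- case=> [_|k kr]; last exact: gC.
  exact/gproj_gorenstein_projective/projective_gproj_dim/free_projective.
- by case=> // k kr; apply: zC.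
- exact: p_surj.
- move=> y; rewrite (ip y) /=; split=> [[x <-]|[x <-]]; last by exists (e x).
  by have [z <-] := e_surj x; exists z.
case=> [|k]; last exact: exS.
move=> y; split=> [h|/ex0 h]; first by apply/ex0/i_inj; rewrite linear0.
by rewrite -[LHS]/(syzygy_incl X (e y)) h linear0.
Qed.

End Gorenstein.

(** * Small pieces of modules of bounded projective dimension *)

Section Restriction.
Variables (R : pzRingType) (T : Type).
Local Notation Phi := (free_module R T).
Implicit Types (P S : T -> Prop) (t : T) (x y : Phi).

Definition restrict P : {linear Phi -> Phi} :=
  free_ext (fun t => if `[< P t >] then delta t else 0).

Lemma restrict_delta P t : restrict P (delta t) = if `[< P t >] then delta t else 0.
Proof. exact: free_ext_delta. Qed.

Lemma coeff_restrict P x t : coeff (restrict P x) t = if `[< P t >] then coeff x t else 0.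
Proof.
have cL : linear (fun y : Phi => coeff (restrict P y) t : R^o).
  by move=> a u v; rewrite linearP coeffP.
have rL : linear (fun y : Phi => (if `[< P t >] then coeff y t else 0) : R^o).
  by move=> a u v; case: ifP => _; rewrite ?coeffP // scaler0 addr0.
apply: (@free_linear_eq _ _ _ (Lin cL) (Lin rL)) => u.
rewrite -[LHS]/(coeff (restrict P (delta u)) t) restrict_delta.
rewrite -[RHS]/(if `[< P t >] then coeff (delta u) t else 0).
case: (asboolP (P u)) => Pu; case: (asboolP (P t)) => Pt; rewrite ?coeff0 // coeff_delta.
  by case: asboolP => // e; case: Pt; rewrite -e.
by case: asboolP => // e; case: Pu; rewrite e.
Qed.

Lemma restrict_span P x : bspan P (restrict P x).
Proof. by move=> t; rewrite coeff_restrict; case: asboolP. Qed.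

Lemma restrict_id P x : bspan P x -> restrict P x = x.
Proof.
move=> Px; apply: coeff_inj => t; rewrite coeff_restrict; case: asboolP => // nPt.
by apply: contrapT => h; case: nPt; apply: Px => e; apply: h.
Qed.

Lemma restrict_0 P x : bspan (fun t => ~ P t) x -> restrict P x = 0.
Proof.
move=> Px; apply: coeff_inj => t; rewrite coeff_restrict coeff0; case: asboolP => // Pt.
by apply: contrapT => h; apply: Px Pt.
Qed.

Lemma restrict_keep P S x : bspan S x -> bspan S (restrict P x).
Proof. by move=> Sx t; rewrite coeff_restrict; case: ifP => // _; apply: Sx. Qed.

Lemma restrict_complement P S x : bspan S x -> bspan (fun t => S t /\ ~ P t) (x - restrict P x).
Proof.
move=> Sx t.
rewrite -[coeff (x - restrict P x) t]/(coeff x t - coeff (restrict P x) t) coeff_restrict.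
by case: asboolP => Pt; rewrite ?subrr // subr0 => /Sx.
Qed.

Lemma bspan_projective P : projective_module (sub_of (@bspan R T P)).
Proof.
have [|r rE] := @factor_inj R _ _ _ (sub_incl (bspan P)) (restrict P) (@sub_incl_inj _ _ _).
  by move=> z; apply/(sub_inclP (bspan P)); exact: restrict_span.
apply: (projective_retract (s := sub_incl (bspan P)) (r := r)); last exact: free_projective.
move=> x; apply: (@sub_incl_inj _ _ (bspan P)); rewrite rE restrict_id //.
exact: sub_valS.
Qed.

Lemma bspan_small P (g : code R -> T) :
  (forall t, P t -> exists c, g c = t) -> small (sub_of (@bspan R T P)).
Proof.
move=> gP; pose i := sub_incl (@bspan R T P).
pose f := lin_comp (restrict P) (free_ext (fun c => delta (g c)) : {linear free_module R (code R) -> Phi}).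
have [|f' f'E] := @factor_inj R _ _ _ i f (@sub_incl_inj _ _ _).
  by move=> z; apply/(sub_inclP (bspan P)); exact: restrict_span.
apply: (small_quotient (p := f')); last first.
  by apply: (@small_free R _ (fun c => c)) => c; exists c.
move=> y; have Py : bspan P (i y) by apply/(sub_inclP (bspan P)); exists y.
suff [z ez] : exists z, f z = i y by exists z; apply: (@sub_incl_inj _ _ (bspan P)); rewrite f'E.
rewrite [i y]free_expand; apply: (free_ext_mem (N := lin_image f)) => t /Py Pt.
have [c ec] := gP t Pt; exists (delta c).
rewrite -[LHS]/(restrict P (free_ext (fun c => delta (g c)) (delta c))) free_ext_delta ec.
by rewrite restrict_id //; apply: bspan_delta.
Qed.

End Restriction.
Arguments restrict {R T} P.

Section ProjectiveResolutions.
Variable R : pzRingType.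
Implicit Types C F K Q : lmodType R.

(** [Q] is isomorphic to the image of [e]. *)
Lemma idempotent_projective F Q (g : {linear F -> Q}) (e : {linear F -> F}) :
  projective_module F -> surjective_map g -> (forall x, e (e x) = e x) ->
  (forall x, g x = 0 <-> e x = 0) -> projective_module Q.
Proof.
move=> pF g_surj ee ge; have [|s sE] := @factor_surj R _ _ _ g e g_surj.
  by move=> x /ge.
apply: (projective_retract (s := s) (r := g)) => // y; have [x <-] := g_surj y.
apply/esym/subr0_eq; rewrite sE -linearB; apply/ge.
by rewrite linearB ee subrr.
Qed.

Lemma resolution_proj_dim r (F : nat -> lmodType R) (d : forall k, {linear F k.+1 -> F k})
    C (p : {linear F 0%N -> C}) Q (i : {linear Q -> F r}) :
  (forall k, projective_module (F k)) -> (forall k, exact_at (d k.+1) (d k)) ->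
  surjective_map p -> exact_at (d 0%N) p ->
  projective_module Q -> injective i -> (forall y, (exists x, i x = y) <-> exists x, d r x = y) ->
  proj_dim_le r.+1 C.
Proof.
elim: r F d C p Q i => [|r IH] F d C p Q i pF dx p_surj px pQ i_inj id Z.
  have se : short_exact i p by split=> // y; rewrite px id.
  by apply/(Ext_vanish_presentation 0 Z se (pF 0%N)); apply: Ext_vanish_projective.
have se := kernel_short_exact p_surj; set j := sub_incl _ in se.
have [j_inj jp _] := se.
have [|q qE] := @factor_inj R _ _ _ j (d 0%N) j_inj.
  by move=> z; apply/jp/px; exists z.
apply/(Ext_vanish_presentation r.+1 Z se (pF 0%N)).
apply: (IH (fun k => F k.+1) (fun k => d k.+1) _ q Q i) => //.
- move=> x; have /px[z ez] : p (j x) = 0 by apply/jp; exists x.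
  by exists z; apply: j_inj; rewrite qE.
- move=> y; rewrite -(dx 0%N y) -qE.
  by split=> [->|e]; [rewrite linear0 | apply: j_inj; rewrite e linear0].
Qed.

End ProjectiveResolutions.

(** A graded free module [Phi], with basis [T] graded by [deg], and a
    differential [d] which is exact in positive degrees: a free resolution of
    [N], the cokernel of [d] in degree zero.  The idempotent [e] in degree
    [r + 1], with the same kernel as [d], makes the image of [d] in degree [r]
    projective, and so bounds the projective dimension of [N] by [r + 1]. *)
Section Deconstruction.
Variables (R : pzRingType) (T : Type) (deg : T -> nat) (r : nat).
Local Notation Phi := (free_module R T).
Variables d e : {linear Phi -> Phi}.
Implicit Types (S D P : T -> Prop) (t : T).

Let homog k := @bspan R T (fun t => deg t = k).

Hypothesis d_deg0 : forall t, deg t = 0%N -> d (delta t) = 0.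
Hypothesis d_degS : forall k t, deg t = k.+1 -> homog k (d (delta t)).
Hypothesis dd : forall x, d (d x) = 0.
Hypothesis d_exact : forall k x, homog k.+1 x -> d x = 0 -> exists y, d y = x.
Hypothesis e_deg : forall x, homog r.+1 x -> homog r.+1 (e x).
Hypothesis ee : forall x, homog r.+1 x -> e (e x) = e x.
Hypothesis e_ker : forall x, homog r.+1 x -> e x = 0 <-> d x = 0.

Lemma d_homog k x : homog k.+1 x -> homog k (d x).
Proof. by apply: bspan_mem => t; apply: d_degS. Qed.

(** Lets the definition of closed sets ignore the grading. *)
Lemma d_component k x :
  d (restrict (fun t => deg t = k.+1) x) = restrict (fun t => deg t = k) (d x).
Proof.
apply: (@free_linear_eq _ _ _ (lin_comp d (restrict _)) (lin_comp (restrict _) d)) => t.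
rewrite -[LHS]/(d (restrict _ (delta t))) -[RHS]/(restrict _ (d (delta t))) restrict_delta; case: asboolP => [et|ne].
  by rewrite restrict_id //; apply: d_degS.
rewrite linear0 restrict_0 //; case et : (deg t) => [|j].
  by rewrite d_deg0 // => u; rewrite coeff0.
by refine (bspan_sub (d_degS et) _) => u -> jk; apply: ne; rewrite et jk.
Qed.

(** The first two conditions say that [d] maps the span of [S] onto its
    intersection with the image of [d].  So the span is again such a resolution,
    and so is the quotient of the spans of two nested closed sets. *)
Definition closed S :=
  [/\ forall t, S t -> bspan S (d (delta t)),
      forall x, bspan S x -> (exists y, d y = x) -> exists y, bspan S y /\ d y = x
    & forall t, S t -> bspan S (e (delta t))].

Lemma closed_d S x : closed S -> bspan S x -> bspan S (d x).
Proof. by move=> [h _ _]; apply: bspan_mem. Qed.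

Lemma closed_e S x : closed S -> bspan S x -> bspan S (e x).
Proof. by move=> [_ _ h]; apply: bspan_mem. Qed.

Lemma closed_lift S k x : closed S -> bspan S x -> homog k x -> (exists y, d y = x) ->
  exists y, [/\ bspan S y, homog k.+1 y & d y = x].
Proof.
move=> [_ h _] Sx hx ex; have [y [Sy dy]] := h x Sx ex.
exists (restrict (fun t => deg t = k.+1) y); split.
- exact: restrict_keep.
- exact: restrict_span.
- by rewrite d_component dy restrict_id.
Qed.

Section Closure.
Variables (S : T -> Prop) (t0 : T) (lift : Phi -> Phi).

(** In the last rule [lift x] stands for a preimage under [d] of [x] modulo the
    span of [S], if there is one; working modulo this span keeps the number of
    new elements small. *)
Inductive closure : T -> Prop :=
  | closure_base : closure t0
  | closure_sub t : S t -> closure t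
  | closure_d t u : closure t -> coeff (d (delta t)) u <> 0 -> closure u
  | closure_e t u : closure t -> coeff (e (delta t)) u <> 0 -> closure u
  | closure_lift x u : (forall t, coeff x t <> 0 -> closure t) ->
      (forall t, coeff x t <> 0 -> ~ S t) -> coeff (lift x) u <> 0 -> closure u.

Hypothesis S_closed : closed S.
Hypothesis liftP : forall x, (exists s y, bspan S s /\ d y = x + s) -> bspan S (d (lift x) - x).

(** Write an image [x] of [d] as the sum of its part [u] off [S] and its part on
    [S].  Then [lift u] maps to [x] up to an error in the span of [S], and the
    error has a preimage because [S] is closed. *)
Lemma closure_closed : closed closure.
Proof.
split.
- by move=> t ct u; apply: closure_d ct.
- move=> x cx [y dy]; set u := x - restrict S x.
  have Ss := @restrict_span R T S x; have cu := restrict_complement (P := S) cx.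
  have Su : bspan S (d (lift u) - u).
    by apply: liftP; exists (restrict S x), y; rewrite subrK.
  have cl : bspan closure (lift u).
    by move=> t ht; apply: (closure_lift (x := u)) ht => v /cu[].
  have [_ h _] := S_closed.
  have [||v [Sv dv]] := h (x - d (lift u)).
  - have -> : x - d (lift u) = restrict S x - (d (lift u) - u).
      by rewrite opprB addrA; congr (_ - _); rewrite /u addrC subrK.
    exact: smemB.
  - by exists (y - lift u); rewrite linearB dy.
  exists (lift u + v); split; last by rewrite linearD dv addrC subrK.
  by apply: smemD => //; refine (bspan_sub Sv _) => t; apply: closure_sub.
- by move=> t ct u; apply: closure_e ct.
Qed.

(** New elements of the closure are named by codes: the lifts are only taken of
    combinations of new elements. *)
Lemma closure_small : exists g : code R -> T, forall t, closure t -> ~ S t -> exists c, g c = t.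
Proof.
pose u (s : seq (R * T)) : Phi := \sum_(a <- s) a.1 *: delta a.2.
pose targets (s : seq (R * T)) : seq {classic T} :=
  t0 :: (supp (d (u s)) ++ supp (e (u s)) ++ supp (lift (u s))).
pose step n s := nth (t0 : {classic T}) (targets s) n.
pose g := decode step.
have reach (s : seq (R * T)) (t : {classic T}) :
    (forall i, (i < size s)%N -> exists c, g c = (nth (0, g (Node 0 [::])) s i).2) ->
    t \in targets s -> exists c, g c = t.
  move=> hs ts; have [c ec] := @decode_closed R T step (index t (targets s)) s hs.
  by exists c; rewrite /g ec /step nth_index.
have reach1 t (v : {classic T}) : (exists c, g c = t) ->
    v \in targets [:: (1, t)] -> exists c, g c = v.
  by move=> ht; apply: reach => -[].
have u1 t : u [:: (1, t)] = delta t by rewrite /u big_seq1 scale1r.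
exists g => t; elim=> {t}.
- by move=> _; apply: (reach [::]) => //; rewrite inE eqxx.
- by [].
- move=> t v ct IH htv nSv; have [St|/IH ht] := EM (S t).
    by case: nSv; have [h _ _] := S_closed; apply: h htv.
  apply: reach1 ht _; rewrite inE !mem_cat u1; apply/orP; right; apply/orP; left.
  exact/mem_supp.
- move=> t v ct IH htv nSv; have [St|/IH ht] := EM (S t).
    by case: nSv; have [_ _ h] := S_closed; apply: h htv.
  apply: reach1 ht _; rewrite inE !mem_cat u1; apply/orP; right; apply/orP; right.
  by apply/orP; left; apply/mem_supp.
- move=> x v cx IH nSx hv nSv.
  pose s := [seq (coeff x t, t : T) | t <- supp x].
  have us : u s = x by rewrite /u /s big_map [RHS]free_expand.
  apply: (reach s); last first.
    by rewrite inE !mem_cat us; do 3!(apply/orP; right); apply/mem_supp.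
  move=> i; rewrite size_map => lti; rewrite (nth_map (t0 : {classic T})) //=.
  have /mem_supp ht := mem_nth (t0 : {classic T}) lti.
  by apply: IH ht (nSx _ ht).
Qed.

End Closure.

Lemma closed_extension S t0 : closed S ->
  exists S' (g : code R -> T),
    [/\ closed S', forall t, S t -> S' t, S' t0 &
        forall t, S' t -> ~ S t -> exists c, g c = t].
Proof.
move=> cS.
have [lift liftP] : {lift : Phi -> Phi & forall x,
    (exists s y, bspan S s /\ d y = x + s) -> bspan S (d (lift x) - x)}.
  apply: (choice (P := fun x y => (exists s z, bspan S s /\ d z = x + s) -> bspan S (d y - x))) => x.
  have [[s [y [Ss dy]]]|no] := EM (exists s y, bspan S s /\ d y = x + s).
    by exists y => _; rewrite dy addrAC subrr add0r.
  by exists 0 => h; case: no.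
have [g gP] := closure_small t0 lift cS.
exists (closure S t0 lift), g; split => //.
- exact: closure_closed.
- exact: closure_sub.
- exact: closure_base.
Qed.

(** The quotient of the spans of two nested closed sets is realized on the span
    of the elements [D] that are in [S'] but not in [S], with differential the
    part [pi] on [D] of [d]. *)
Section Layer.
Variables (S S' : T -> Prop) (g : code R -> T).
Hypotheses (cS : closed S) (cS' : closed S') (SS' : forall t, S t -> S' t).
Hypothesis g_surj : forall t, S' t -> ~ S t -> exists c, g c = t.

Let D t := S' t /\ ~ S t.
Let Dk k t := D t /\ deg t = k.
Let F k : lmodType R := sub_of (@bspan R T (Dk k)).
Let j k : {linear F k -> Phi} := sub_incl (bspan (Dk k)).
Let pi : {linear Phi -> Phi} := restrict D.

Let jD k x : bspan D (j k x).
Proof. by move=> t /(sub_valS x)[]. Qed.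

Let jh k x : homog k (j k x).
Proof. by move=> t /(sub_valS x)[]. Qed.

Let jS' k x : bspan S' (j k x).
Proof. by refine (bspan_sub (@jD k x) _) => t []. Qed.

Let j_inj k : injective (j k).
Proof. exact: sub_incl_inj. Qed.

Let j_surj k x : bspan D x -> homog k x -> exists y, j k y = x.
Proof. by move=> hD hh; apply/(sub_inclP (bspan (Dk k))) => t ht; split; [exact: hD | exact: hh]. Qed.

Let pi_S x : bspan S x -> pi x = 0.
Proof. by move=> Sx; apply: restrict_0; refine (bspan_sub Sx _) => t St []. Qed.

Let pi_D x : bspan D x -> pi x = x.
Proof. exact: restrict_id. Qed.

Let pi_j k x : pi (j k x) = j k x.
Proof. exact/pi_D/jD. Qed.

Let sub_pi x : bspan S' x -> bspan S (x - pi x).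
Proof.
move=> S'x; refine (bspan_sub (restrict_complement (P := D) S'x) _) => t [S't nDt].
by apply: contrapT => nSt; apply: nDt.
Qed.

Let pi_eq0 x : bspan S' x -> pi x = 0 -> bspan S x.
Proof. by move=> /sub_pi h e0; rewrite -[x]subr0 -e0. Qed.

Let pi_homog k x : homog k x -> homog k (pi x).
Proof. exact: restrict_keep. Qed.

Let pi_span x : bspan D (pi x).
Proof. exact: restrict_span. Qed.

Let dj_S' k x : bspan S' (d (j k x)).
Proof. exact/(closed_d cS')/jS'. Qed.

Fact layer_d_exists k :
  exists f : {linear F k.+1 -> F k}, forall x, j k (f x) = pi (d (j k.+1 x)).
Proof.
have [|f fE] := @factor_inj R _ _ _ (j k) (lin_comp pi (lin_comp d (j k.+1))) (@j_inj k).
  move=> x; apply: j_surj; first exact: pi_span.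
  by apply: pi_homog; apply: d_homog; apply: jh.
by exists f.
Qed.

Let dF k : {linear F k.+1 -> F k} := projT1 (cid (layer_d_exists k)).
Let dFE k x : j k (dF k x) = pi (d (j k.+1 x)).
Proof. by rewrite /dF; case: cid. Qed.

(* A cycle of the quotient differs from a cycle of [Phi] by the span of [S]. *)
Let dF_eq0 k x : dF k x = 0 -> exists s, [/\ bspan S s, homog k.+1 s & d s = d (j k.+1 x)].
Proof.
move=> /(congr1 (j k)); rewrite dFE linear0 => /(pi_eq0 (@dj_S' _ x)) h.
by apply: closed_lift => //; [apply: d_homog; apply: jh | exists (j k.+1 x)].
Qed.

Let dF_exact k : exact_at (dF k.+1) (dF k).
Proof.
move=> x; split=> [/dF_eq0[s [Ss hs ds]]|[y <-]].
  have S's : bspan S' s := bspan_sub Ss SS'.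
  have hxs : homog k.+1 (j k.+1 x - s) by apply: smemB => //; apply: jh.
  have [|||y [S'y hy dy]] := @closed_lift S' k.+1 (j k.+1 x - s) cS'.
  - by apply: smemB => //; apply: jS'.
  - exact: hxs.
  - by apply: (d_exact hxs); rewrite linearB ds subrr.
  have [z ez] := j_surj (@pi_span y) (pi_homog hy).
  exists z; apply: j_inj; rewrite dFE ez.
  have Sd : bspan S (d (y - pi y)) by apply: (closed_d cS); apply: sub_pi.
  by move: (pi_S Sd); rewrite !linearB dy !linearB pi_j (pi_S Ss) subr0 => /subr0_eq.
apply: j_inj; rewrite dFE dFE linear0.
have := sub_pi (@dj_S' _ y); set u := d _ => Su.
have Sd : bspan S (d (u - pi u)) by apply: (closed_d cS).
by move: (pi_S Sd); rewrite linearB dd sub0r linearN => /eqP; rewrite oppr_eq0 => /eqP.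
Qed.

Let eF_exists : exists f : {linear F r.+1 -> F r.+1}, forall x, j r.+1 (f x) = pi (e (j r.+1 x)).
Proof.
have [|f fE] := @factor_inj R _ _ _ (j r.+1) (lin_comp pi (lin_comp e (j r.+1))) (@j_inj _).
  move=> x; apply: j_surj; first exact: pi_span.
  by apply: pi_homog; apply: e_deg; apply: jh.
by exists f.
Qed.

Let image_projective : projective_module (sub_of (lin_image (dF r))).
Proof.
have [eF eFE] := eF_exists; set i := sub_incl (lin_image (dF r)).
have [|q qE] := @factor_inj R _ _ _ i (dF r) (@sub_incl_inj _ _ _).
  by move=> z; apply/(sub_inclP (lin_image (dF r))); exists z.
have ej_S' x : bspan S' (e (j r.+1 x)) by apply: (closed_e cS'); apply: jS'.
apply: (@idempotent_projective R (F r.+1) _ q eF).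
- exact: bspan_projective.
- move=> y; have /sub_inclP[x ex] : exists y', i y' = i y by exists y.
  by exists x; apply: (@sub_incl_inj _ _ (lin_image (dF r))); rewrite qE.
- move=> x; apply: j_inj; rewrite eFE eFE.
  have := sub_pi (@ej_S' x); set u := e _ => Su.
  have Se : bspan S (e (u - pi u)) by apply: (closed_e cS).
  move: (pi_S Se); rewrite !linearB /u ee; last exact: jh.
  by move/subr0_eq.
- move=> x; have -> : q x = 0 <-> dF r x = 0.
    split=> [h|h]; first by rewrite -qE h linear0.
    by apply: (@sub_incl_inj _ _ (lin_image (dF r))); rewrite -/i qE h linear0.
  split=> [/dF_eq0[s [Ss hs ds]]|h].
    have hxs : homog r.+1 (j r.+1 x - s) by apply: smemB => //; apply: jh.
    have exs : e (j r.+1 x) = e s.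
      by apply/subr0_eq; rewrite -linearB; apply/(e_ker hxs); rewrite linearB ds subrr.
    by apply: j_inj; rewrite eFE exs linear0; apply: pi_S; apply: (closed_e cS).
  have Se : bspan S (e (j r.+1 x)).
    by apply: (pi_eq0 (@ej_S' x)); rewrite -eFE h linear0.
  have hj := @jh _ x; have hxe : homog r.+1 (j r.+1 x - e (j r.+1 x)).
    by apply: smemB => //; apply: e_deg.
  have dxe : d (j r.+1 x) = d (e (j r.+1 x)).
    apply/subr0_eq; rewrite -linearB; apply/(e_ker hxe).
    by rewrite linearB ee // subrr.
  by apply: j_inj; rewrite dFE dxe linear0; apply: pi_S; apply: (closed_d cS).
Qed.

(** The obstruction to extending [G] from [S] to [S'] is a map on the first
    syzygy of the module [C] resolved by the quotient; it extends because [C] is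
    small and has projective dimension at most [r + 1]. *)
Lemma layer_extend (Y : lmodType R) (G phi : {linear Phi -> Y}) :
  (forall A : lmodType R, proj_dim_le r.+1 A -> small A -> Ext1_eq0 A Y) ->
  (forall x, homog 1 x -> d x = 0 -> phi x = 0) ->
  (forall t, S t -> deg t = 1%N -> G (d (delta t)) = phi (delta t)) ->
  exists G' : {linear Phi -> Y},
    (forall t, S t -> G' (delta t) = G (delta t)) /\
    (forall t, S' t -> deg t = 1%N -> G' (d (delta t)) = phi (delta t)).
Proof.
move=> extY phi0 GS.
have GS1 x : bspan S x -> homog 1 x -> G (d x) = phi x.
  move=> Sx hx; have Px : bspan (fun t => S t /\ deg t = 1%N) x.
    by move=> t ht; split; [exact: Sx | exact: hx].
  apply/subr0_eq.
  refine (bspan_mem (N := kernel (sub_lin (lin_comp G d) phi)) (f := id_lin Phi) _ Px) => t [St et].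
  by rewrite /= GS // subrr.
have [C [p [p_surj pE]]] := quotient_exists (lin_image (dF 0%N)).
have pC : proj_dim_le r.+1 C.
  apply: (resolution_proj_dim (F := F) (d := dF) (p := p) (i := sub_incl (lin_image (dF r)))) => //.
  - by move=> k; apply: bspan_projective.
  - exact: sub_incl_inj.
  - by move=> y; have := sub_inclP (lin_image (dF r)) y => -[h1 h2]; split=> [/h2|/h1].
have sC : small C.
  by apply: (small_quotient p_surj); apply: (bspan_small (g := g)) => t [[S't nSt] _]; apply: g_surj.
have se := kernel_short_exact p_surj; set i := sub_incl _ in se.
have [i_inj ip _] := se.
have [|q qE] := @factor_inj R _ _ _ i (dF 0%N) i_inj.
  by move=> z; apply/ip/pE; exists z.
have q_surj : surjective_map q.
  move=> y; have /pE[x ex] : p (i y) = 0 by apply/ip; exists y.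
  by exists x; apply: i_inj; rewrite qE.
(* What [phi] still requires on [D], given the values of [G] on [S]. *)
pose psi := sub_lin (lin_comp phi (j 1%N))
  (lin_comp G (sub_lin (lin_comp d (j 1%N)) (lin_comp pi (lin_comp d (j 1%N))))).
have psiE x : psi x = phi (j 1%N x) - G (d (j 1%N x) - pi (d (j 1%N x))) by [].
have [|psi' psi'E] := @factor_surj R _ _ _ q psi q_surj.
  move=> x qx; have {}qx : dF 0%N x = 0 by rewrite -qE qx linear0.
  have pidx : pi (d (j 1%N x)) = 0 by rewrite -dFE qx linear0.
  have [s [Ss hs ds]] := dF_eq0 qx.
  rewrite psiE pidx subr0 -ds GS1 // -linearB; apply: phi0.
    by apply: smemB => //; apply: jh.
  by rewrite linearB ds subrr.
have [h hE] := Ext1_extend psi' se (extY C pC sC).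
have [|rho rhoE] := @factor_inj R _ _ _ (j 0%N) (restrict (Dk 0)) (@j_inj 0%N).
  move=> z; have := @restrict_span R T (Dk 0) z => hz.
  by apply: j_surj => t /hz[].
have hL : linear (fun x => G (restrict S x) + h (rho x)).
  by move=> a u v; rewrite !linearP addrACA scalerDr.
have hLE x : Lin hL x = G (restrict S x) + h (rho x) by [].
exists (Lin hL); split=> t St; first rewrite hLE.
  have -> : rho (delta t) = 0.
    apply: j_inj; rewrite rhoE linear0; apply: restrict_0.
    by apply: bspan_delta => -[[_ nSt]].
  by rewrite linear0 addr0 restrict_id //; apply: bspan_delta.
move=> et; rewrite hLE; have [iSt|nSt] := EM (S t).
  have Sd : bspan S (d (delta t)) by apply: (closed_d cS); apply: bspan_delta.
  have -> : rho (d (delta t)) = 0.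
    apply: j_inj; rewrite rhoE linear0; apply: restrict_0.
    by refine (bspan_sub Sd _) => u Su [[_ nSu]].
  by rewrite linear0 addr0 restrict_id // GS.
have Dt : bspan D (delta t : Phi) := bspan_delta (S := D) (conj St nSt).
have ht : homog 1 (delta t) := bspan_delta (S := fun u => deg u = 1%N) et.
have [x ex] := j_surj Dt ht.
have hd : homog 0 (d (delta t)) := d_degS (k := 0) et.
have S'd : bspan S' (d (delta t)) := closed_d cS' (bspan_delta (S := S') St).
have -> : rho (d (delta t)) = i (q x).
  apply: j_inj; rewrite rhoE qE dFE ex; apply: coeff_inj => u; rewrite !coeff_restrict.
  have [e0|/hd eu] := EM (coeff (d (delta t)) u = 0); first by rewrite e0; do 2!case: ifP.
  by congr (if _ then _ else _); apply/asbool_equiv_eq; split=> [[]|].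
have -> : restrict S (d (delta t)) = d (delta t) - pi (d (delta t)).
  apply: coeff_inj => u.
  rewrite -[RHS]/(coeff (d (delta t)) u - coeff (pi (d (delta t))) u) !coeff_restrict.
  have [e0|/S'd S'u] := EM (coeff (d (delta t)) u = 0).
    by rewrite e0; do 2!case: ifP; rewrite subrr.
  case: (asboolP (S u)) => Su; case: (asboolP (D u)) => Du; rewrite ?subrr ?subr0 //.
    by case: Du.
  by case: Du.
by rewrite hE psi'E psiE ex addrC subrK.
Qed.

End Layer.

Lemma chain_bspan (I : Type) (C : I -> Prop) (S : I -> T -> Prop) (x : Phi) :
  (exists c, C c) ->
  (forall b c, C b -> C c -> (forall t, S b t -> S c t) \/ (forall t, S c t -> S b t)) ->
  bspan (fun t => exists c, C c /\ S c t) x -> exists c, C c /\ bspan (S c) x.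
Proof.
move=> [c0 Cc0] tot Ux.
have [c [Cc hc]] : exists c, C c /\ forall t : {classic T}, t \in supp x -> S c t.
  have : forall t : {classic T}, t \in supp x -> exists c, C c /\ S c t.
    by move=> t /mem_supp/Ux.
  elim: (supp x) => [|t s IH] h; first by exists c0.
  have [|c [Cc hc]] := IH; first by move=> u us; apply: h; rewrite inE us orbT.
  have [b [Cb hb]] := h t (mem_head _ _).
  have [bc|cb] := tot b c Cb Cc.
    by exists c; split=> // u; rewrite inE => /orP[/eqP->|/hc //]; apply: bc.
  by exists b; split=> // u; rewrite inE => /orP[/eqP-> //|/hc/cb].
by exists c; split=> // t /mem_supp/hc.
Qed.

(** By Zorn's lemma, applied to the solutions on closed sets; their order [le]
    by extension is only a preorder, because it compares the values on the closed
    sets alone.  A maximal solution is total, since it extends to the next closed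
    set. *)
Lemma graded_extend (Y : lmodType R) (phi : {linear Phi -> Y}) :
  (forall A : lmodType R, proj_dim_le r.+1 A -> small A -> Ext1_eq0 A Y) ->
  (forall x, homog 1 x -> d x = 0 -> phi x = 0) ->
  exists G : {linear Phi -> Y}, forall t, deg t = 1%N -> G (d (delta t)) = phi (delta t).
Proof.
move=> extY phi0.
pose good (a : (T -> Prop) * {linear Phi -> Y}) :=
  closed a.1 /\ forall t, a.1 t -> deg t = 1%N -> a.2 (d (delta t)) = phi (delta t).
pose Z := {a | good a}; pose dom (a : Z) := (sval a).1; pose map (a : Z) := (sval a).2.
pose le (a b : Z) := forall t, dom a t -> dom b t /\ map b (delta t) = map a (delta t).
have closed0 : closed (fun _ => False).
  split=> // x x0 _; exists 0; split; first exact: smem0.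
  rewrite linear0; apply: coeff_inj => t; rewrite coeff0.
  by apply: contrapT => h; apply: (x0 t) => e0; apply: h.
have good0 : good (fun _ => False, phi) by [].
have [||C Cne totC|a amax] := @Zorn_maximal Z (exist _ _ good0) le.
- by move=> a t at_.
- by move=> a b c ab bc t /ab[/bc[bt ->] ->].
- have tot a b : C a -> C b -> (forall t, dom a t -> dom b t) \/ (forall t, dom b t -> dom a t).
    by move=> Ca Cb; have [h|h] := totC a b Ca Cb; [left|right] => t /h[].
  pose U t := exists a, C a /\ dom a t.
  have [h hP] : {h : T -> Y & forall t, forall a, C a -> dom a t -> h t = map a (delta t)}.
    apply: (choice (P := fun t y => forall a, C a -> dom a t -> y = map a (delta t))) => t.
    have [[a [Ca at_]]|no] := EM (U t); last by exists 0 => a Ca at_; case: no; exists a.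
    exists (map a (delta t)) => b Cb bt.
    by have [/(_ t at_)[]|/(_ t bt)[]] := totC a b Ca Cb.
  have agree a x : C a -> bspan (dom a) x -> free_ext h x = map a x.
    move=> Ca ax; rewrite [RHS]linear_free_ext; apply: free_ext_eq => t /ax at_.
    exact: hP.
  have closedU : closed U.
    split.
    - move=> t [a [Ca at_]]; have [[ca _ _] _] := svalP a.
      by refine (bspan_sub (ca t at_) _) => u au; exists a.
    - move=> x Ux ex; have [a [Ca ax]] := chain_bspan Cne tot Ux.
      have [[_ ca _] _] := svalP a; have [y [ay dy]] := ca x ax ex.
      by exists y; split=> //; refine (bspan_sub ay _) => u au; exists a.
    - move=> t [a [Ca at_]]; have [[_ _ ca] _] := svalP a.
      by refine (bspan_sub (ca t at_) _) => u au; exists a.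
  have goodU : good (U, free_ext h).
    split=> // t [a [Ca at_]] et; have [[ca _ _] ga] := svalP a.
    by rewrite (agree a) //; [exact: ga | exact: ca].
  exists (exist _ _ goodU) => a Ca t at_; split; first by exists a.
  by rewrite /map /= [LHS](agree a) //; exact: (bspan_delta (S := dom a) at_).
have [cS gS] := svalP a; exists (map a) => t et.
have [St|nSt] := EM (dom a t); first exact: gS.
have [S' [g [cS' SS' S't hg]]] := closed_extension t cS.
have [G [GS GS']] := layer_extend cS cS' SS' hg extY phi0 gS.
have good' : good (S', G) by [].
case: nSt; have [|] := amax (exist _ _ good') _ t S't => //.
by move=> u Su; split; [exact: SS' | exact: GS].
Qed.

End Deconstruction.

Section Syzygies.
Variables (R : pzRingType) (N : lmodType R) (r : nat).

Let S k := iter k (@syzygy R) N.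
Let T := {k : nat & S k}.
Let Phi := free_module R T.
Let emb k : {linear free_module R (S k) -> Phi} := free_ext (fun b => delta (existT S k b)).

Let ret_fun k (t : T) : free_module R (S k) :=
  if pselect (projT1 t = k) is left e then delta (eq_rect _ S (projT2 t) _ e) else 0.
Let ret k : {linear Phi -> free_module R (S k)} := free_ext (@ret_fun k).

Let emb_delta k b : emb k (delta b) = delta (existT S k b).
Proof. exact: free_ext_delta. Qed.

Let embK k x : ret k (emb k x) = x.
Proof.
apply: (@free_linear_eq _ _ _ (lin_comp (ret k) (emb k)) (id_lin _)) => b.
rewrite -[LHS]/(ret k (emb k (delta b))) emb_delta /ret free_ext_delta /ret_fun.
by case: pselect => // e; rewrite (eq_irrelevance e (erefl k)).
Qed.

Let emb_inj k : injective (emb k).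
Proof. exact: can_inj (@embK k). Qed.

Let homog k (x : Phi) := bspan (fun t : T => projT1 t = k) x.

Let emb_homog k x : homog k (emb k x).
Proof. by apply: free_ext_mem => b _; apply: bspan_delta. Qed.

Let homog_emb k x : homog k x -> exists y, emb k y = x.
Proof.
move=> hx; rewrite [x]free_expand; apply: (free_ext_mem (N := lin_image (emb k))) => -[j b] /hx /= ej.
by subst j; exists (delta b); apply: free_ext_delta.
Qed.

Let d_fun (t : T) : Phi :=
  match t with
  | existT 0 _ => 0
  | existT k.+1 b => emb k (syzygy_incl (S k) b)
  end.
Let d : {linear Phi -> Phi} := free_ext d_fun.

Let d_delta t : d (delta t) = d_fun t.
Proof. exact: free_ext_delta. Qed.

Let d_emb0 x : d (emb 0 x) = 0.
Proof.
apply: (@free_linear_eq _ _ _ (lin_comp d (emb 0)) (zero_lin _ _)) => b.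
by rewrite -[LHS]/(d (emb 0 (delta b))) emb_delta d_delta.
Qed.

Let d_embS k x : d (emb k.+1 x) = emb k (syzygy_incl (S k) (free_cover (S k.+1) x)).
Proof.
apply: (@free_linear_eq _ _ _ (lin_comp d (emb k.+1))
  (lin_comp (emb k) (lin_comp (syzygy_incl (S k)) (free_cover (S k.+1))))) => b.
rewrite -[LHS]/(d (emb k.+1 (delta b))) emb_delta d_delta.
rewrite -[RHS]/(emb k (syzygy_incl (S k) (free_cover (S k.+1) (delta b)))).
by rewrite [free_cover _ _]free_ext_delta.
Qed.

Let incl0 k x : syzygy_incl (S k) x = 0 -> x = 0.
Proof. by move=> h; apply: (@sub_incl_inj _ _ (kernel (free_cover (S k)))); rewrite linear0. Qed.

Let cover_incl k x : free_cover (S k) (syzygy_incl (S k) x) = 0.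
Proof. exact: short_exact_comp0 (syzygy_exact (S k)). Qed.

(** Take the canonical free resolution of [N], all degrees put together in one
    free module; the idempotent [e] comes from a section [s] of the free cover of
    the projective syzygy in degree [r + 1]. *)
Lemma small_proj_dim_Ext1 (Y : lmodType R) :
  projective_module (S r.+1) ->
  (forall A : lmodType R, proj_dim_le r.+1 A -> small A -> Ext1_eq0 A Y) -> Ext1_eq0 N Y.
Proof.
move=> /projective_summand[s sK] extY.
pose e : {linear Phi -> Phi} :=
  lin_comp (emb r.+1) (lin_comp s (lin_comp (free_cover (S r.+1)) (ret r.+1))).
have eE x : e (emb r.+1 x) = emb r.+1 (s (free_cover (S r.+1) x)).
  by rewrite -[LHS]/(emb r.+1 (s (free_cover (S r.+1) (ret r.+1 (emb r.+1 x))))) embK.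
apply: (Ext1_of_extend (syzygy_exact N)); first exact/projective_Ext1/free_projective.
move=> f; pose phi := lin_comp f (lin_comp (free_cover (S 1%N)) (ret 1%N)).
have phiE x : phi (emb 1%N x) = f (free_cover (S 1%N) x).
  by rewrite -[LHS]/(f (free_cover (S 1%N) (ret 1%N (emb 1%N x)))) embK.
have d0 k x : d (emb k.+1 x) = 0 -> free_cover (S k.+1) x = 0.
  by rewrite d_embS => h; apply: incl0; apply: (@emb_inj k); rewrite h linear0.
have [||||||||G GE] := @graded_extend R T (@projT1 nat S) r d e _ _ _ _ _ _ _ Y phi extY.
- by move=> [k b] ek; have {}ek : k = 0%N := ek; subst k; rewrite d_delta.
- move=> k [j b] ej; have {}ej : j = k.+1 := ej; subst j; rewrite d_delta.
  exact: emb_homog.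
- apply: (@free_linear_eq _ _ _ (lin_comp d d) (zero_lin _ _)) => -[[|[|k]] b].
  + by rewrite -[LHS]/(d (d (delta _))) d_delta linear0.
  + by rewrite -[LHS]/(d (d (delta _))) [d (delta _)]d_delta d_emb0.
  + by rewrite -[LHS]/(d (d (delta _))) [d (delta _)]d_delta d_embS cover_incl !linear0.
- move=> k _ /homog_emb[x <-] /d0 h; have [_ ip _] := syzygy_exact (S k.+1).
  have [b eb] := (ip x).1 h; exists (delta (existT S k.+2 b)).
  by rewrite d_delta -eb.
- move=> x _; exact: emb_homog.
- by move=> _ /homog_emb[x <-]; rewrite [e (emb r.+1 x)]eE [LHS]eE sK.
- move=> _ /homog_emb[x <-]; rewrite eE d_embS.
  suff e0 y : emb r.+1 (s y) = 0 <-> emb r (syzygy_incl (S r) y) = 0 by apply: e0.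
  split=> h; last first.
    have /incl0 -> : syzygy_incl (S r) y = 0 by apply: (@emb_inj r); rewrite h linear0.
    by rewrite !linear0.
  have sy : s y = 0 by apply: (@emb_inj r.+1); rewrite h linear0.
  by rewrite -[y]sK sy !linear0.
- by move=> _ /homog_emb[x <-] /d0 h; rewrite phiE h linear0.
exists (lin_comp G (emb 0)) => b.
have Gb := GE (existT S 1%N b) erefl; rewrite d_delta in Gb.
rewrite -[LHS]/(G (emb 0%N (syzygy_incl N b))) [LHS]Gb -emb_delta phiE.
by rewrite [free_cover _ _]free_ext_delta.
Qed.

End Syzygies.

(** * The cotorsion pair *)

Section CotorsionPair.
Variables (R : pzRingType) (n r : nat).
Hypotheses (gorR : n_gorenstein n R) (r_gt0 : (0 < r)%N).
Implicit Types A B X Y : lmodType R.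

Local Notation GP := (gproj_dim_le (R := R) n r).

(** The preenvelope [N] of [M] has projective dimension at most [n], and at most
    [r] because its [r]-th syzygy is also Gorenstein-projective; the groups of
    [N] vanish since it is built from small modules, and those of [G] since [Y]
    has injective dimension at most [n]. *)
Lemma small_orth_gproj Y : small_orth GP Y -> right_orth GP Y.
Proof.
move=> oY; have hY := small_orth_inj_dim oY.
move=> M gM; have [N [G [j [q [se hN gG]]]]] := inj_dim_preenvelope n M.
have gN : GP N := gproj_dim_middle se gM (gproj_dim_le0 gG).
apply: (Ext_vanish_left (k := 0) se); last exact: (gproj_dim_le0 (k := 1) gG).
move: r_gt0 gN oY; case: (r) => // s _ gN oY.
apply: (@small_proj_dim_Ext1 R N s Y) => [|A pA sA]; last first.
  by apply: oY; split=> // Z _; apply: pA.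
apply: (gproj_proj_dim_projective gorR (m := n)); first exact: gproj_dim_syzygy.
move=> Z; rewrite -Ext_vanish_add; apply: proj_dim_leW.
exact: inj_dim_proj_dim hN.
Qed.

(** The cosyzygies of order [r] of the modules of injective dimension at most [n]
    are orthogonal to [GP], and already detect it. *)
Lemma double_orth_gproj X : left_orth (right_orth GP) X -> GP X.
Proof.
move=> h Y hY; apply/Ext_vanish_iter; apply: h => A gA.
exact/Ext_vanish_iter/gA.
Qed.

Lemma gproj_special_preenvelope X :
  exists A B (f : {linear X -> B}) (g : {linear B -> A}),
    [/\ GP A, right_orth GP B & short_exact f g].
Proof.
have [B [A [j [q [se oB oA]]]]] := small_orth_preenvelope GP X.
exists A, B, j, q; split=> //; last exact: small_orth_gproj.
by apply: double_orth_gproj => Y oY; apply: oA => C [gC _]; apply: oY.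
Qed.

(** Salce's argument: push out a free presentation of [X] along a special
    preenvelope of its kernel. *)
Lemma gproj_special_precover X :
  exists A B (f : {linear B -> A}) (g : {linear A -> X}),
    [/\ GP A, right_orth GP B & short_exact f g].
Proof.
have [A [B [j [q [gA oB seB]]]]] := gproj_special_preenvelope (syzygy X).
have [P [u [v [uv sp ker]]]] := pushout_exists (syzygy_incl X) j.
have [w [seP _]] := pushout_short_exact (syzygy_exact X) uv sp ker.
have [w' [seP' _]] : exists w', short_exact u w' /\ forall x, w' (v x) = q x.
  apply: (pushout_short_exact seB) => [k|z|x y /esym/ker[k [<- <-]]].
  - exact/esym/uv.
  - by have [x [y ->]] := sp z; exists y, x; rewrite addrC.
  - by exists k.
exists P, B, v, w; split=> //.
apply: (gproj_dim_middle seP' _ gA).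
exact/projective_gproj_dim/free_projective.
Qed.

End CotorsionPair.

Theorem corollary4p3 (R : pzRingType) (n r : nat) :
  n_gorenstein n R -> (0 < r <= n)%N ->
  complete_cotorsion_pair (gorenstein_projective_dim_le (R := R) r)
    (right_orth (gorenstein_projective_dim_le (R := R) r)).
Proof.
move=> gorR /andP[r_gt0 _].
have -> : gorenstein_projective_dim_le (R := R) r = gproj_dim_le n r.
  by apply/funext => X; apply/propext/gorenstein_projective_dimP.
split; first split=> // X; first split=> [gX Y|].
- exact.
- exact: double_orth_gproj.
by split; [apply: gproj_special_precover | apply: gproj_special_preenvelope].
Qed.
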